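(* Let $0<\lambda<1$, $\varepsilon>0$, $\delta>0$, and let $T$ be a positive integer. Assume that $(N,r,\tau)$ are admissible for accuracy $\varepsilon'=\lambda\varepsilon$ and failure probability $\delta$ (as defined in the context). Let $L>0$ be a Lipschitz constant of $\nabla f$ on $S_0$ (with respect to the Frobenius norm), and let the step size satisfy $\alpha\in\left(0,\frac{2(1-\lambda)}{L}\right)$. Let $\{K_i\}_{i=0}^{T'}$ be the sequence generated by the Policy Gradient Projection algorithm started at $K_0$ with parameters $T,\alpha,\varepsilon,N,r,\tau$, where $T'\le T$ is the total number of iterations. Then, with probability greater than $1-T\delta$, the following hold: 1. The sequence $\{K_i\}_{i=0}^{T'}$ remains in $S$ and $\{f(K_i)\}_{i=0}^{T'}$ is strictly decreasing, i.e. $f(K_{i+1})<f(K_i)$ for all $0\le i\le T'-1$. 2. If $T>\dfrac{f(K_0)}{\varepsilon^2\alpha^2\left(\frac{1-\lambda}{\alpha}-\frac L2\right)}$, then $K_{T'}$ is a $(1+\lambda)\varepsilon$-stationary point.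
   Context: Setting. $A\in\mathbb R^{n\times n}$, $B\in\mathbb R^{n\times m}$, $C\in\mathbb R^{p\times n}$ with $B\ne0$, $C\neq 0$; $Q\in\mathbb R^{p\times p}$, $R\in\mathbb R^{m\times m}$ are (symmetric) positive definite; $\mathcal D$ is a probability distribution on $\mathbb R^n$ with $\Sigma:=E_{x(0)\sim\mathcal D}[x(0)x(0)^\top]\succ0$ and $\|x(0)\|\le P$ almost surely for a constant $P>0$; the pair $(A,C)$ is observable. For $K\in\mathbb R^{m\times p}$ put $A_K:=A-BKC$ and $S:=\{K\in\mathbb R^{m\times p}: A_K\text{ is Hurwitz}\}$ (all eigenvalues have negative real part). $\Omega\subset\mathbb R^{m\times p}$ is a closed convex set, and $K_0\in\Omega\cap S$ is given. For $K\in S$, $$f(K):=E_{x(0)\sim\mathcal D}\left[\int_0^\infty x(0)^\top e^{A_K^\top t}C^\top(Q+K^\top RK)Ce^{A_Kt}x(0)\,dt\right].$$ $S_0:=\{K\in S: f(K)\le f(K_0)\}$. $\|\cdot\|_F$ is the Frobenius norm, and $\operatorname{proj}$ is the orthogonal projection of $\mathbb R^{m\times p}$ onto $\Omega$ in the Frobenius norm. Gradient estimate. For parameters $N\in\mathbb N$, $r>0$, $\tau>0$ and $K\in\mathbb R^{m\times p}$, sample $U_1,\dots,U_N$ independently from the uniform distribution on $\{U\in\mathbb R^{m\times p}:\|U\|_F=\sqrt{mp}\}$ and, independently, $x_1(0),\dots,x_N(0)$ independently from $\mathcal D$. With $K_i':=K+rU_i$, let $x_i(t)=e^{A_{K_i'}t}x_i(0)$,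 $y_i(t)=Cx_i(t)$, $u_i(t)=-K_i'y_i(t)$, $c_i=\int_0^\tau [y_i(t)^\top Qy_i(t)+u_i(t)^\top Ru_i(t)]\,dt$, and $$\hat\nabla f(K):=\frac1{rN}\sum_{i=1}^Nc_iU_i .$$ Admissibility. $(N,r,\tau)$ are admissible for accuracy $\varepsilon'$ and failure probability $\delta$ if they are chosen as $r=O(\varepsilon')$, $\tau=O(\log(1/\varepsilon'))$, $N=O((\log(1/\delta))/\varepsilon'^4)$ in such a way that, for every $K\in S_0$, $\|\hat\nabla f(K)-\nabla f(K)\|_F\le\varepsilon'$ holds with probability greater than $1-\delta$. Policy Gradient Projection algorithm. For $i=0,1,\dots,T-1$: compute $\hat\nabla f(K_i)$ with fresh independent samples; set $K_{i+1}:=\operatorname{proj}(K_i-\alpha\hat\nabla f(K_i))$; if $\|K_{i+1}-K_i\|_F\le\varepsilon\alpha$, stop, return $K_i$ and put $T':=i$. If the algorithm never stops in the loop, return $K_T$ and put $T':=T$. Stationarity. For $\alpha>0$ and $\epsilon>0$, $K$ is an $\epsilon$-stationary point if $\|G_\alpha(K)\|_F\le\epsilon$, where $G_\alpha(K):=\frac1\alpha(K^+-K)$ and $K^+:=\operatorname{proj}(K-\alpha\nabla f(K))$. *)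

(* Defs.v *)
From HB Require Import structures.
From mathcomp Require Import all_boot all_order all_algebra.
From mathcomp Require Import complex.
From mathcomp Require Import all_classical all_reals all_analysis.
Set Implicit Arguments.
Unset Strict Implicit.
Unset Printing Implicit Defensive.
Import Order.TTheory GRing.Theory Num.Theory.
Import numFieldNormedType.Exports.
Local Open Scope classical_set_scope.
Local Open Scope ring_scope.

Section linear_algebra.
Variable R : realType.

(* On column vectors this is the Euclidean norm; the library norm `|M| on
   matrices is the max norm, which defines the same topology. *)
Definition frob m n (M : 'M[R]_(m, n)) : R :=
  Num.sqrt (\sum_i \sum_j M i j ^+ 2).

Definition posdef n (M : 'M[R]_n) : Prop :=
  M^T = M /\ forall x : 'cV[R]_n, x != 0 -> 0 < (x^T *m M *m x) 0 0.

Definition hurwitz n (M : 'M[R]_n) : Prop :=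
  forall z : R[i], eigenvalue (map_mx (real_complex R) M) z -> complex.Re z < 0.

Definition expmx n (M : 'M[R]_n) : 'M[R]_n :=
  limn (series (fun k => k`!%:R^-1 *: (M ^+ k))).

(* Full column rank of the stacked matrix [C; CA; ...; CA^(n-1)]. *)
Definition observable n p (A : 'M[R]_n) (C : 'M[R]_(p, n)) : Prop :=
  \rank (\mxcol_(k < n) (C *m A ^+ k)) = n.

Definition gradient m p (f : 'M[R]_(m, p) -> R) (K : 'M[R]_(m, p)) :
  'M[R]_(m, p) := \matrix_(i, j) 'D_(delta_mx i j) f K.

(* Frobenius-nearest point of Omega (unique when Omega is closed, convex and
   nonempty). *)
Definition proj m p (Omega : set 'M[R]_(m, p)) (K : 'M[R]_(m, p)) :
  'M[R]_(m, p) :=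
  get [set Y | Omega Y /\ forall Z, Omega Z -> frob (K - Y) <= frob (K - Z)].

End linear_algebra.

Notation borel_mx R m n :=
  (g_sigma_algebraType (@open ('M[R]_(m, n) : topologicalType))).

Section probability_notions.
Context (R : realType) (d : measure_display) (S : measurableType d).
Variable P : probability S R.

(* "E holds with probability greater than c", without presupposing that E is
   measurable; for measurable E this is c < P E. *)
Definition holds_with_prob_gt (c : R) (E : set S) : Prop :=
  exists F : set S, [/\ measurable F, F `<=` E & (c%:E < P F)%E].

Definition mutually_independent (I : finType) (G : I -> set (set S)) : Prop :=
  forall (J : {set I}) (E : I -> set S), (forall i, i \in J -> G i (E i)) ->
    P (\bigcap_(i in [set` J]) E i) = (\prod_(i in J) P (E i))%E.

Definition sigma_of d' (T : measurableType d') (X : {RV P >-> T}) :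
  set (set S) := preimage_set_system setT X measurable.

End probability_notions.

(* The uniform distribution on the sphere of radius rho is the unique Borel
   probability carried by the sphere and invariant under all linear
   isometries. *)
Definition uniform_on_sphere (R : realType) m p (rho : R)
    (mu : probability (borel_mx R m p) R) : Prop :=
  mu [set M | frob M = rho] = 1%E /\
  forall phi : {linear 'M[R]_(m, p) -> 'M[R]_(m, p)},
    (forall M, frob (phi M) = frob M) ->
    forall E : set (borel_mx R m p), measurable E -> mu (phi @^-1` E) = mu E.

Section policy_gradient.
Variables (R : realType) (n m p : nat).
Variables (A : 'M[R]_n) (B : 'M[R]_(n, m)) (C : 'M[R]_(p, n)).
Variables (Q : 'M[R]_p) (W : 'M[R]_m).
Variable D : probability (borel_mx R n 1) R.
Implicit Type K : 'M[R]_(m, p).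

Definition closed_loop K : 'M[R]_n := A - B *m K *m C.

Definition stabilizing : set 'M[R]_(m, p) := [set K | hurwitz (closed_loop K)].

Definition trajectory_cost K (x : 'cV[R]_n) : R :=
  \int[lebesgue_measure]_(t in `[0%R, +oo[)
     (x^T *m expmx (t *: (closed_loop K)^T) *m C^T *m (Q + K^T *m W *m K)
        *m C *m expmx (t *: closed_loop K) *m x) 0 0.

(* Only the values at stabilizing K, where everything is finite, are
   meaningful. *)
Definition cost K : R := fine 'E_D[trajectory_cost K].

Definition sublevel K0 : set 'M[R]_(m, p) :=
  [set K | stabilizing K /\ cost K <= cost K0].

Definition second_moment : 'M[R]_n :=
  \matrix_(i, j) fine 'E_D[(fun x : 'cV[R]_n => x i 0 * x j 0)%R].

Definition sample_cost (tau : R) K (x0 : 'cV[R]_n) : R :=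
  let x t := expmx (t *: closed_loop K) *m x0 in
  let y t := C *m x t in
  let u t := - (K *m y t) in
  \int[lebesgue_measure]_(t in `[0%R, tau])
     (((y t)^T *m Q *m y t) 0 0 + ((u t)^T *m W *m u t) 0 0).

Definition gradient_estimate (N : nat) (r tau : R) K
    (U : 'I_N -> 'M[R]_(m, p)) (x0 : 'I_N -> 'cV[R]_n) : 'M[R]_(m, p) :=
  (r * N%:R)^-1 *: \sum_k sample_cost tau (K + r *: U k) (x0 k) *: U k.

Definition iid_samples d (S : measurableType d) (P : probability S R)
    (I : finType) (U : I -> {RV P >-> borel_mx R m p})
    (X : I -> {RV P >-> borel_mx R n 1}) : Prop :=
  [/\ forall i, uniform_on_sphere (Num.sqrt (m * p)%:R) (distribution P (U i)),
      forall i E, measurable E -> distribution P (X i) E = D E &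
      mutually_independent P (fun s : I + I => match s with
        | inl i => sigma_of (U i)
        | inr i => sigma_of (X i)
        end)].

(* The probability of the event depends only on the law of the samples, so the
   choice of the sample space in this definition is immaterial. *)
Definition accurate (N : nat) (r tau e delta : R) K : Prop :=
  forall d (S : measurableType d) (P : probability S R)
    (U : 'I_N -> {RV P >-> borel_mx R m p})
    (X : 'I_N -> {RV P >-> borel_mx R n 1}),
    iid_samples U X ->
    holds_with_prob_gt P (1 - delta)
      [set w | frob (gradient_estimate r tau K (U ^~ w) (X ^~ w)
                     - gradient cost K) <= e].

(* (N, r, tau) is the value at q = (e, delta) of a selection rule with
   r = O(e), tau = O(log (1/e)) and N = O(log (1/delta) / e^4) as e and delta
   tend to 0+. The growth rates constrain the rule, not the individual values. *)
Definition admissible K0 (N : nat) (r tau e delta : R) : Prop :=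
  let F : set_system (R * R) := filter_prod 0^'+ 0^'+ in
  [/\ (0 < N)%N, 0 < r, 0 < tau,
      exists (Nf : R * R -> nat) (rf tauf : R * R -> R),
        [/\ rf =O_F (fun q => q.1),
            tauf =O_F (fun q => ln q.1^-1),
            (fun q => (Nf q)%:R : R) =O_F
              (fun q => ln q.2^-1 / q.1 ^+ 4) &
            [/\ N = Nf (e, delta), r = rf (e, delta) & tau = tauf (e, delta)]] &
      forall K, sublevel K0 K -> accurate N r tau e delta K].

Definition gradient_mapping (Omega : set 'M[R]_(m, p)) (alpha : R) K :
  'M[R]_(m, p) :=
  alpha^-1 *: (proj Omega (K - alpha *: gradient cost K) - K).

Definition stationary (Omega : set 'M[R]_(m, p)) (alpha e : R) K : Prop :=
  frob (gradient_mapping Omega alpha K) <= e.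

(* For one outcome of the samples, U i and x0 i being those of iteration i. The
   recursion ignores the stopping test; the algorithm generates
   pgp_iterate i for i <= pgp_stop T only. *)
Section algorithm.
Variables (Omega : set 'M[R]_(m, p)) (K0 : 'M[R]_(m, p)).
Variables (alpha eps : R) (N : nat) (r tau : R).
Variables (U : nat -> 'I_N -> 'M[R]_(m, p)) (x0 : nat -> 'I_N -> 'cV[R]_n).

Fixpoint pgp_iterate (i : nat) : 'M[R]_(m, p) :=
  if i is j.+1 then
    proj Omega (pgp_iterate j
      - alpha *: gradient_estimate r tau (pgp_iterate j) (U j) (x0 j))
  else K0.

(* The least i < T passing the stopping test, and T if there is none. *)
Definition pgp_stop (T : nat) : nat :=
  find (fun i => frob (pgp_iterate i.+1 - pgp_iterate i) <= eps * alpha)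
    (iota 0 T).

End algorithm.

End policy_gradient.

(* Main.v *)
(* A real matrix is Hurwitz iff it has a quadratic Lyapunov function
   (one is built from a weighted Schur basis). On stabilizing gains the cost is
   tr (P_K Sigma), where P_K solves the Lyapunov equation; perturbing this equation
   shows that the stabilizing gains form an open set on which the cost is locally
   Lipschitz and has directional derivatives <grad f, V>. Sublevel sets are closed:
   along gains of bounded cost the matrices P_K stay bounded, so an eigenvector of
   a limit with Re z >= 0 would be unobservable. Hence, while the estimate is
   accurate to lambda * eps, the segment from K to its projected step cannot leave
   the sublevel set, and each step longer than eps * alpha lowers the cost by at
   least eps^2 alpha^2 ((1 - lambda) / alpha - L / 2). At step i the gain depends on
   the past samples and the estimate on fresh independent ones, so by Fubini the
   event that K_i lies in the sublevel set and its estimate is inaccurate has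
   probability < delta; a union bound over the T steps concludes. *)

From HB Require Import structures.
From Pilot Require Import Defs.
From mathcomp Require Import all_boot all_order all_algebra.
From mathcomp Require Import complex.
From mathcomp Require Import all_classical all_reals all_analysis.
From mathcomp Require Import measurable_realfun.
From mathcomp Require Import ring lra.
Import Order.TTheory GRing.Theory Num.Theory.
Import numFieldNormedType.Exports.
Set Implicit Arguments.
Unset Strict Implicit.
Unset Printing Implicit Defensive.
Local Open Scope classical_set_scope.
Local Open Scope ring_scope.

(** * Frobenius inner product and projections *)

(** The cost is under control on the stabilizing gains only, and its gradient is Lipschitz on the
    sublevel set only, which need not be convex or connected. The usual descent lemma therefore
    cannot be applied along a projected step: that the whole segment stays in the sublevel set has
    to be proved together with the decrease, by continuation in the segment parameter. All estimates
    near a gain rest on one device: a single quadratic form [P] certifies every closed loop in a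
    neighbourhood, and on symmetric matrices the inverse Lyapunov operator is bounded in terms of
    [P] and the decay constant alone. This takes the place of the implicit function theorem; only
    directional derivatives and a local Lipschitz bound are extracted. On the random side, accuracy
    is assumed for each fixed gain, not simultaneously for all gains. Since nothing is assumed about
    the gradient outside the sublevel set, the bad events are cut down to that set, and the gradient
    is replaced by 0 elsewhere to make them measurable. *)

Section frobenius.
Context {R : realType} {m n : nat}.
Implicit Types M N K : 'M[R]_(m, n).

Definition mxdot M N : R := \sum_i \sum_j M i j * N i j.

Lemma mxdotC M N : mxdot M N = mxdot N M.
Proof. by apply: eq_bigr => i _; apply: eq_bigr => j _; rewrite mulrC. Qed.

Lemma mxdotDl M1 M2 N : mxdot (M1 + M2) N = mxdot M1 N + mxdot M2 N.
Proof.
rewrite -big_split; apply: eq_bigr => i _ /=; rewrite -big_split.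
by apply: eq_bigr => j _ /=; rewrite mxE mulrDl.
Qed.

Lemma mxdotZl a M N : mxdot (a *: M) N = a * mxdot M N.
Proof.
rewrite mulr_sumr; apply: eq_bigr => i _; rewrite mulr_sumr.
by apply: eq_bigr => j _; rewrite mxE mulrA.
Qed.

Lemma mxdotNl M N : mxdot (- M) N = - mxdot M N.
Proof. by rewrite -scaleN1r mxdotZl mulN1r. Qed.

Lemma mxdotDr M N1 N2 : mxdot M (N1 + N2) = mxdot M N1 + mxdot M N2.
Proof. by rewrite mxdotC mxdotDl !(mxdotC M). Qed.

Lemma mxdotZr a M N : mxdot M (a *: N) = a * mxdot M N.
Proof. by rewrite mxdotC mxdotZl mxdotC. Qed.

Lemma mxdotNr M N : mxdot M (- N) = - mxdot M N.
Proof. by rewrite mxdotC mxdotNl mxdotC. Qed.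

Definition mxdotE := (mxdotDl, mxdotDr, mxdotNl, mxdotNr, mxdotZl, mxdotZr).

Lemma mxdot_ge0 M : 0 <= mxdot M M.
Proof. by do 2![apply: sumr_ge0 => ? _]; rewrite -expr2 sqr_ge0. Qed.

Lemma frob_sqr M : frob M ^+ 2 = mxdot M M.
Proof.
rewrite /frob sqr_sqrtr; last by do 2![apply: sumr_ge0 => ? _]; rewrite sqr_ge0.
by apply: eq_bigr => i _; apply: eq_bigr => j _; rewrite expr2.
Qed.

Lemma frob_ge0 M : 0 <= frob M. Proof. exact: sqrtr_ge0. Qed.

Lemma le_frob_sqr M N : (frob M <= frob N) = (frob M ^+ 2 <= frob N ^+ 2).
Proof. by rewrite ler_pXn2r// nnegrE frob_ge0. Qed.

Lemma coord_le_frob M i j : `|M i j| <= frob M.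
Proof.
rewrite -sqrtr_sqr ler_sqrt; last by do 2![apply: sumr_ge0 => ? _]; rewrite sqr_ge0.
rewrite (bigD1 i)//= (bigD1 j)//= -addrA lerDl addr_ge0//.
  by apply: sumr_ge0 => ? _; rewrite sqr_ge0.
by do 2![apply: sumr_ge0 => ? _]; rewrite sqr_ge0.
Qed.

Lemma frob0_eq0 M : frob M = 0 -> M = 0.
Proof.
move=> M0; apply/matrixP => i j; rewrite mxE; apply/eqP.
by rewrite -normr_le0 -M0 coord_le_frob.
Qed.

Lemma frobZ a M : frob (a *: M) = `|a| * frob M.
Proof.
apply/eqP; rewrite -(@eqrXn2 _ 2)// ?mulr_ge0 ?frob_ge0//.
by rewrite exprMn !frob_sqr !mxdotE real_normK ?num_real// expr2 mulrA.
Qed.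

Lemma frobN M : frob (- M) = frob M.
Proof. by rewrite -scaleN1r frobZ normrN1 mul1r. Qed.

Lemma frobB M N : frob (M - N) = frob (N - M).
Proof. by rewrite -frobN opprB. Qed.

Lemma mxdot_CS M N : mxdot M N <= frob M * frob N.
Proof.
have [N0|N0] := eqVneq (frob N) 0.
  by rewrite N0 (frob0_eq0 N0) mulr0 -(scale0r 0) mxdotZr mul0r.
have Ngt0 : 0 < frob N by rewrite lt_neqAle eq_sym N0 frob_ge0.
(* This matrix is [frob N ^+ 2] times the component of [M] orthogonal to [N]. *)
have := mxdot_ge0 (frob N ^+ 2 *: M - mxdot M N *: N).
rewrite !mxdotE (mxdotC N M) -!frob_sqr => h.
have {}h : 0 <= frob N ^+ 2 * (frob M ^+ 2 * frob N ^+ 2 - mxdot M N ^+ 2).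
  by apply: le_trans h _; rewrite le_eqVlt; apply/orP; left; apply/eqP; ring.
move: h; rewrite pmulr_rge0 ?exprn_gt0// subr_ge0 -exprMn => h.
apply: le_trans (ler_norm _) _.
by rewrite -(@ler_pXn2r _ 2)// ?nnegrE ?mulr_ge0 ?frob_ge0// real_normK ?num_real.
Qed.

Lemma frobD M N : frob (M + N) <= frob M + frob N.
Proof.
rewrite -(@ler_pXn2r _ 2)// ?nnegrE ?addr_ge0 ?frob_ge0//.
rewrite frob_sqr !mxdotE (mxdotC N M) -!frob_sqr sqrrD.
by have := mxdot_CS M N; lra.
Qed.

Lemma mxnorm_le_frob M : `|M| <= frob M.
Proof.
rewrite /Num.norm /= mx_normrE; apply/bigmax_leP; split; first exact: frob_ge0.
by move=> [i j] _; exact: coord_le_frob.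
Qed.

Lemma coord_le_mxnorm M i j : `|M i j| <= `|M|.
Proof.
rewrite [leRHS]/Num.norm /= mx_normrE; apply/bigmax_geP; right.
by exists (i, j).
Qed.

Lemma frob_le_mxnorm M : frob M <= Num.sqrt (m * n)%:R * `|M|.
Proof.
rewrite -[X in _ * X]ger0_norm// -sqrtr_sqr -sqrtrM ?ler0n//.
rewrite ler_wsqrtr// natrM -!mulrA.
have h i : \sum_j M i j ^+ 2 <= n%:R * `|M| ^+ 2.
  rewrite mulr_natl -[X in _ *+ X]card_ord -sumr_const; apply: ler_sum => j _.
  by rewrite -real_normK ?num_real// lerXn2r ?nnegrE// coord_le_mxnorm.
rewrite mulr_natl -[X in _ *+ X]card_ord -sumr_const.
by apply: ler_sum => i _.
Qed.

(** The topology comes from the max norm; equivalence of the two norms lets neighbourhoods be tested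
    with Frobenius balls. *)
Lemma frob_nbhs K (A : set 'M[R]_(m, n)) :
  nbhs K A <-> exists2 e, 0 < e & forall N, frob (N - K) < e -> A N.
Proof.
split=> [/nbhs_normP[e e0 eA]|[e e0 eA]].
  exists e => // N Ne; apply: eA; rewrite /ball_ /= distrC.
  exact: le_lt_trans (mxnorm_le_frob _) Ne.
pose c : R := Num.sqrt (m * n)%:R.
have c0 : 0 < c + 1 by rewrite ltr_wpDl// sqrtr_ge0.
apply/nbhs_ballP; exists (e / (c + 1)); first exact: divr_gt0.
move=> N; rewrite -ball_normE /ball_ /= distrC ltr_pdivlMr// => Ne; apply: eA.
apply: le_lt_trans Ne; apply: le_trans (frob_le_mxnorm _) _.
by rewrite mulrC ler_wpM2l// lerDl.
Qed.

Lemma frob_lip_continuous (f : 'M[R]_(m, n) -> R) (c : R) :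
  (forall M N, `|f M - f N| <= c * frob (M - N)) -> continuous f.
Proof.
move=> fc M; apply: (@cvgrPdist_lt _ R^o _ (nbhs M) _ _ _).2 => e e0.
have c0 : 0 < `|c| + 1 by rewrite ltr_wpDl.
apply/frob_nbhs; exists (e / (`|c| + 1)); first exact: divr_gt0.
move=> N; rewrite ltr_pdivlMr// => NM; apply: le_lt_trans (fc _ _) _.
rewrite frobB; apply: le_lt_trans NM; rewrite mulrC ler_wpM2l ?frob_ge0//.
by apply: le_trans (ler_norm _) _; rewrite lerDl.
Qed.

Lemma frob_dist_continuous K : continuous (fun M => frob (K - M)).
Proof.
apply: (@frob_lip_continuous _ 1) => M N; rewrite mul1r ler_norml.
have := frobD (K - M) (M - N); have := frobD (K - N) (N - M).
rewrite !addrA !subrK (frobB N M); lra.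
Qed.

End frobenius.

Local Notation proj := Pilot.Defs.proj.

(** * Orthogonal projection onto a closed convex set *)

Section projection.
Context {R : realType} {m p : nat}.
Variable Omega : set 'M[R]_(m, p).
Hypothesis Oclosed : closed Omega.
Hypothesis Oconvex : convex_set (Omega : set (convex_lmodType 'M[R]_(m, p))).
Hypothesis O0 : Omega !=set0.
Implicit Types K Y Z : 'M[R]_(m, p).

(** Heine-Borel, imported from row vectors through the continuous map [vec_mx]. *)
Lemma mx_closed_bounded_compact (A : set 'M[R]_(m, p)) (r : R) :
  closed A -> (forall M, A M -> frob M <= r) -> compact A.
Proof.
move=> Acl Ar.
have cbox : compact [set v : 'rV[R]_(m * p) | forall i, v ord0 i \in `[- r, r]].
  apply: (@rV_compact R _ (fun=> `[- r, r]%classic)).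
  by move=> _; exact: segment_compact.
have cvm : continuous (vec_mx : 'rV[R]_(m * p) -> 'M[R]_(m, p)).
  move=> v V /nbhs_ballP[e e0 eV].
  apply/nbhs_ballP; exists e => // w [_ vw]; apply: eV; split=> // i j.
  by rewrite !mxE; exact: vw.
apply: subclosed_compact Acl (continuous_compact (continuous_subspaceT cvm) cbox) _.
move=> M AM /=; exists (mxvec M); last exact: mxvecK.
move=> k /=; case/mxvec_indexP: k => i j.
rewrite mxvecE in_itv/= -ler_norml.
exact: le_trans (coord_le_frob _ _ _) (Ar _ AM).
Qed.

Lemma convex_segment Y Z (t : R) : Omega Y -> Omega Z -> 0 <= t -> t <= 1 ->
  Omega (Y + t *: (Z - Y)).
Proof.
move=> OY OZ t0 t1.
have := Oconvex (Itv01 t0 t1) (mem_set (OZ : (Omega : set (convex_lmodType 'M[R]_(m, p))) Z)) (mem_set OY).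
move/set_mem; rewrite /conv /=.
by congr Omega; rewrite scalerBr scalerBl scale1r addrCA.
Qed.

(** The distance to [K] attains its minimum on the compact part of [Omega] that is no farther from
    [K] than some [Y0]. This makes the choice by [get] in [proj] meaningful. *)
Lemma projP K : Omega (proj Omega K) /\
  forall Z, Omega Z -> frob (K - proj Omega K) <= frob (K - Z).
Proof.
rewrite /proj; apply: (@getPex _
  [set Y | Omega Y /\ forall Z, Omega Z -> frob (K - Y) <= frob (K - Z)]).
have [Y0 OY0] := O0.
pose A := Omega `&` [set Z | frob (K - Z) <= frob (K - Y0)].
have cf := @frob_dist_continuous _ _ _ K.
have Ac : compact A.
  apply: (@mx_closed_bounded_compact _ (frob K + frob (K - Y0))).
    apply: closedI => //.
    have := @closed_comp _ _ (fun Z => frob (K - Z)) [set x | x <= frob (K - Y0)].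
    by apply; [move=> ? _; exact: cf|exact: closed_le].
  move=> M [_ /= MK]; rewrite -(subKr K M).
  apply: le_trans (frobD _ _) _; rewrite frobN lerD2l//.
have [] := @compact_EVT_min _ R _ A _ Ac (continuous_subspaceT cf).
  by exists Y0; split=> /=.
move=> Y /set_mem[OY YY0] Ymin; exists Y; split=> // Z OZ.
have [ZY0|/ltW ZY0] := leP (frob (K - Z)) (frob (K - Y0)).
  by apply: Ymin; apply/mem_set.
exact: le_trans YY0 ZY0.
Qed.

(** Otherwise a short move from the projection towards [Z], inside [Omega] by convexity, would come
    closer to [K]. *)
Lemma proj_variational K Z : Omega Z ->
  mxdot (K - proj Omega K) (Z - proj Omega K) <= 0.
Proof.
move=> OZ; have [OY Ymin] := projP K; set Y := proj Omega K in OY Ymin *.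
rewrite leNgt; apply/negP => d0.
set d := mxdot _ _ in d0; set q := mxdot (Z - Y) (Z - Y).
have q0 : 0 <= q by exact: mxdot_ge0.
(* Moving by [t] changes the squared distance by [- 2 t d + t^2 q]. This [t] is positive, at most 1,
   and satisfies [t q = d - t d], so the change is negative; the case [q = 0] is included. *)
pose t := d / (d + q).
have t0 : 0 < t by rewrite divr_gt0// ltr_wpDr.
have t1 : t <= 1 by rewrite ler_pdivrMr ?ltr_wpDr// mul1r lerDl.
have := Ymin _ (convex_segment OY OZ (ltW t0) t1).
rewrite le_frob_sqr !frob_sqr opprD addrA [leRHS]mxdotDl !(mxdotDr _ (K - Y)).
rewrite mxdotNr !mxdotNl !mxdotNr !(mxdotZl, mxdotZr) -/d -/q.
have tdq : t * (d + q) = d by rewrite divfK// gt_eqF// ltr_wpDr.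
have h : t * (t * q) = t * (d - t * d) by congr (_ * _); move: tdq; rewrite mulrDr; lra.
rewrite opprK h.
have td0 : 0 < t * d by exact: mulr_gt0.
have ttd0 : 0 < t * (t * d) by exact: mulr_gt0.
rewrite (mxdotC (Z - Y)) -/d mulrBr; lra.
Qed.

(** Adding the variational inequalities at the two projections bounds their squared distance by an
    inner product; Cauchy-Schwarz then removes one factor. *)
Lemma proj_nonexpansive K Z :
  frob (proj Omega K - proj Omega Z) <= frob (K - Z).
Proof.
set Y := proj Omega K; set X := proj Omega Z.
have h1 : mxdot (K - Y) (X - Y) <= 0 by apply: proj_variational; case: (projP Z).
have h2 : mxdot (Z - X) (Y - X) <= 0 by apply: proj_variational; case: (projP K).
have h : frob (Y - X) ^+ 2 <= mxdot (K - Z) (Y - X).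
  rewrite frob_sqr.
  move: h1 h2; rewrite !(mxdotDl, mxdotDr, mxdotNl, mxdotNr).
  by rewrite (mxdotC X Y); lra.
have [->|X0] := eqVneq (frob (Y - X)) 0; first exact: frob_ge0.
have Xgt0 : 0 < frob (Y - X) by rewrite lt_neqAle eq_sym X0 frob_ge0.
rewrite -(ler_pM2r Xgt0) -expr2; exact: le_trans h (mxdot_CS _ _).
Qed.

Lemma proj_continuous : continuous (proj Omega).
Proof.
move=> K A /frob_nbhs[e e0 eA]; apply/frob_nbhs; exists e => // N NK.
exact/eA/(le_lt_trans (proj_nonexpansive _ _)).
Qed.

End projection.

(** * Quadratic Lyapunov functions of Hurwitz matrices *)

Section complex_parts.
Context {R : realType}.
Implicit Types (z : R[i]).

Lemma Re_sum (I : Type) (s : seq I) (F : I -> R[i]) :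
  complex.Re (\sum_(i <- s) F i) = \sum_(i <- s) complex.Re (F i).
Proof. by elim/big_rec2 : _ => [//|i y1 y2 _ <-]; case: (F i) y2 => [? ?] []. Qed.

Lemma Im_sum (I : Type) (s : seq I) (F : I -> R[i]) :
  complex.Im (\sum_(i <- s) F i) = \sum_(i <- s) complex.Im (F i).
Proof. by elim/big_rec2 : _ => [//|i y1 y2 _ <-]; case: (F i) y2 => [? ?] []. Qed.

Definition remx m n (M : 'M[R[i]]_(m, n)) : 'M[R]_(m, n) := map_mx (@complex.Re R) M.
Definition immx m n (M : 'M[R[i]]_(m, n)) : 'M[R]_(m, n) := map_mx (@complex.Im R) M.

Lemma remxM m n p (M : 'M[R[i]]_(m, n)) (N : 'M[R[i]]_(n, p)) :
  remx (M *m N) = remx M *m remx N - immx M *m immx N.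
Proof.
apply/matrixP => i j; rewrite !mxE Re_sum -sumrB; apply: eq_bigr => k _.
by rewrite !mxE; case: (M i k) (N k j) => [? ?] [].
Qed.

Lemma immxM m n p (M : 'M[R[i]]_(m, n)) (N : 'M[R[i]]_(n, p)) :
  immx (M *m N) = remx M *m immx N + immx M *m remx N.
Proof.
apply/matrixP => i j; rewrite !mxE Im_sum -big_split; apply: eq_bigr => k _.
by rewrite !mxE; case: (M i k) (N k j) => [? ?] [].
Qed.

Lemma remx_real m n (M : 'M[R]_(m, n)) : remx (map_mx (real_complex R) M) = M.
Proof. by apply/matrixP => i j; rewrite !mxE. Qed.

Lemma immx_real m n (M : 'M[R]_(m, n)) : immx (map_mx (real_complex R) M) = 0.
Proof. by apply/matrixP => i j; rewrite !mxE. Qed.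

Lemma remx_adj m n (M : 'M[R[i]]_(m, n)) :
  remx (map_mx Num.conj M^T) = (remx M)^T.
Proof. by apply/matrixP => i j; rewrite !mxE; case: (M j i). Qed.

Lemma immx_adj m n (M : 'M[R[i]]_(m, n)) :
  immx (map_mx Num.conj M^T) = - (immx M)^T.
Proof. by apply/matrixP => i j; rewrite !mxE; case: (M j i). Qed.

Lemma complex_mx_eq m n (M N : 'M[R[i]]_(m, n)) :
  remx M = remx N -> immx M = immx N -> M = N.
Proof.
move=> /matrixP r /matrixP s; apply/matrixP => i j.
by have := r i j; have := s i j; rewrite !mxE; case: (M i j) (N i j) => [? ?] [? ?] /= -> ->.
Qed.

Lemma unitarymx_parts n (U : 'M[R[i]]_n) : U \is unitarymx ->
  (remx U)^T *m remx U + (immx U)^T *m immx U = 1%:M.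
Proof.
move=> Uu; have := mulVmx (unitarymx_unit Uu); rewrite invmx_unitary//.
move=> /(congr1 (@remx _ _)); rewrite remxM remx_adj immx_adj mulNmx opprK => ->.
by apply/matrixP => i j; rewrite !mxE; case: eqP.
Qed.

End complex_parts.

Section bilinear.
Context {R : realType} {n : nat}.
Implicit Types (P M : 'M[R]_n) (x y : 'cV[R]_n).

Definition bil P x y : R := (x^T *m P *m y) 0 0.

Lemma bilDl P x1 x2 y : bil P (x1 + x2) y = bil P x1 y + bil P x2 y.
Proof. by rewrite /bil linearD/= !mulmxDl mxE. Qed.

Lemma bilDr P x y1 y2 : bil P x (y1 + y2) = bil P x y1 + bil P x y2.
Proof. by rewrite /bil mulmxDr mxE. Qed.

Lemma bilZl P a x y : bil P (a *: x) y = a * bil P x y.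
Proof. by rewrite /bil linearZ/= -!scalemxAl mxE. Qed.

Lemma bilZr P a x y : bil P x (a *: y) = a * bil P x y.
Proof. by rewrite /bil -scalemxAr mxE. Qed.

Lemma bilNl P x y : bil P (- x) y = - bil P x y.
Proof. by rewrite -scaleN1r bilZl mulN1r. Qed.

Lemma bilNr P x y : bil P x (- y) = - bil P x y.
Proof. by rewrite -scaleN1r bilZr mulN1r. Qed.

Lemma bilDm P M x y : bil (P + M) x y = bil P x y + bil M x y.
Proof. by rewrite /bil mulmxDr mulmxDl mxE. Qed.

Lemma bilZm a P x y : bil (a *: P) x y = a * bil P x y.
Proof. by rewrite /bil -scalemxAr -scalemxAl mxE. Qed.

Lemma bilNm P x y : bil (- P) x y = - bil P x y.
Proof. by rewrite -scaleN1r bilZm mulN1r. Qed.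

Lemma bilE P x y : bil P x y = \sum_i \sum_j x i 0 * P i j * y j 0.
Proof.
rewrite /bil -mulmxA mxE; apply: eq_bigr => i _; rewrite !mxE mulr_sumr.
by apply: eq_bigr => j _; rewrite mulrA.
Qed.

Lemma bil_sym P x y : P^T = P -> bil P x y = bil P y x.
Proof.
move=> Ps; rewrite /bil -[x^T *m P *m y]trmxK mxE.
by rewrite !trmx_mul trmxK Ps mulmxA.
Qed.

Lemma bil1 x y : bil 1%:M x y = mxdot x y.
Proof.
by rewrite /bil mulmx1 mxE; apply: eq_bigr => i _; rewrite big_ord1 mxE.
Qed.

Lemma bil_mulr P M x y : bil P x (M *m y) = bil (P *m M) x y.
Proof. by rewrite /bil !mulmxA. Qed.

Lemma bil_mull P M x y : bil P (M *m x) y = bil (M^T *m P) x y.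
Proof. by rewrite /bil trmx_mul !mulmxA. Qed.

Lemma bil_delta P i j : bil P (delta_mx i 0) (delta_mx j 0) = P i j.
Proof.
rewrite bilE (bigD1 i)//= (bigD1 j)//= !mxE !eqxx mul1r mulr1 big1 ?addr0; last first.
  by move=> k kj; rewrite !mxE (negbTE kj) mulr0.
rewrite big1 ?addr0// => k ki; rewrite big1// => l _.
by rewrite !mxE (negbTE ki)/= !mul0r.
Qed.

Lemma bil_entry_bound P (e : R) x y : (forall i j, `|P i j| <= e) ->
  `|bil P x y| <= e * (n * n)%:R * (frob x * frob y).
Proof.
move=> Pe; rewrite bilE; apply: le_trans (ler_norm_sum _ _ _) _.
rewrite natrM mulrA (mulrC e) -!mulrA mulr_natl -[X in _ *+ X]card_ord -sumr_const.
apply: ler_sum => i _; apply: le_trans (ler_norm_sum _ _ _) _.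
rewrite (mulrCA e) mulr_natl -[X in _ *+ X]card_ord -sumr_const.
apply: ler_sum => j _; rewrite !normrM (mulrC `|x i 0|) -mulrA.
by rewrite [leRHS]mulrCA; apply: ler_pM; rewrite ?mulr_ge0//; apply: ler_pM; rewrite ?coord_le_frob.
Qed.

End bilinear.

Lemma fin_pos_lower_bound (R : realType) (I : finType) (F : I -> R) :
  (forall i, 0 < F i) -> exists2 mu, 0 < mu & forall i, mu <= F i.
Proof.
move=> F0; exists (\big[Num.min/1]_i F i); last by move=> i; exact: bigmin_le_cond.
by elim/big_ind : _ => // x y x0 y0; rewrite lt_min x0.
Qed.

Section lyapunov_certificate.
Context {R : realType} {n : nat}.
Implicit Types (A P : 'M[R]_n) (x y : 'cV[R]_n).

Definition lyap_cert A P (a b : R) : Prop :=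
  [/\ 0 < a, 0 < b, P^T = P & forall x, a * mxdot x x <= bil P x x /\
    bil P x (A *m x) <= - b * mxdot x x].

Definition csq (x y : 'cV[R]_n) (k : 'I_n) : R := x k 0 ^+ 2 + y k 0 ^+ 2.

(* The weights [eta ^+ (2 * k)] play the part of a diagonal similarity that
   shrinks the off-diagonal entries of the triangular matrix [S + iT]. *)
Lemma trig_weighted_decay (S T : 'M[R]_n) :
  (forall i j : 'I_n, (i < j)%N -> S i j = 0 /\ T i j = 0) ->
  (forall i, S i i < 0) ->
  exists (h : 'I_n -> R) (b : R), [/\ (forall k, 0 < h k), 0 < b &
    forall x y, \sum_k h k * (x k 0 * (S *m x - T *m y) k 0
                             + y k 0 * (S *m y + T *m x) k 0) <=
      - b * \sum_k h k * csq x y k].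
Proof.
move=> ST Sneg.
have [|mu mu0 muS'] := @fin_pos_lower_bound R 'I_n (fun i => - S i i).
  by move=> i; rewrite oppr_gt0.
have muS i : S i i <= - mu by rewrite lerNr.
pose M : R := \sum_i \sum_j (`|S i j| + `|T i j|).
have MST i j : `|S i j| + `|T i j| <= M.
  rewrite /M (bigD1 i)//= (bigD1 j)//= -addrA lerDl addr_ge0//.
    by apply: sumr_ge0 => ? _; rewrite addr_ge0.
  by do 2![apply: sumr_ge0 => ? _]; rewrite addr_ge0.
have M0 : 0 <= M by do 2![apply: sumr_ge0 => ? _]; rewrite addr_ge0.
have D0 : 0 < 2 * n%:R * M + mu + 1.
  by rewrite ltr_wpDl// addr_ge0 ?(ltW mu0)// !mulr_ge0.
(* This [eta] is at most 1 and makes [eta * M * n] at most [mu / 2], so that all off-diagonal terms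
   together consume at most half of the diagonal decay. *)
pose eta := mu / (2 * n%:R * M + mu + 1).
have eta0 : 0 < eta by exact: divr_gt0.
have eta1 : eta <= 1.
  rewrite ler_pdivrMr// mul1r.
  have : 0 <= 2 * n%:R * M by rewrite !mulr_ge0.
  by lra.
have etaM : eta * (2 * n%:R * M) <= mu.
  rewrite mulrAC ler_pdivrMr// ler_wpM2l ?(ltW mu0)//; lra.
exists (fun k : 'I_n => (eta ^+ k) ^+ 2), (mu / 2); split=> [k||x y].
- by rewrite !exprn_gt0.
- by rewrite divr_gt0.
pose E (k : 'I_n) := (eta ^+ k) ^+ 2 * csq x y k.
have E0 k : 0 <= E k by rewrite mulr_ge0 ?addr_ge0 ?sqr_ge0.
have rest0 (k l : 'I_n) : 0 <= eta * M / 2 * (E k + E l).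
  by rewrite mulr_ge0 ?addr_ge0// divr_ge0// mulr_ge0// ltW.
have term (k l : 'I_n) :
  (eta ^+ k) ^+ 2 * (x k 0 * (S k l * x l 0 - T k l * y l 0)
                + y k 0 * (S k l * y l 0 + T k l * x l 0)) <=
  (if l == k then - mu * E k else 0) + eta * M / 2 * (E k + E l).
  case: eqP => [->|/eqP lk].
    rewrite [leLHS](_ : _ = S k k * E k); last by rewrite /E /csq; ring.
    by apply: ler_wpDr; [exact: rest0|exact: ler_wpM2r].
  have [kl|kl|kl] := ltngtP k l.
  - by have [-> ->] := ST _ _ kl; rewrite !mul0r subr0 addr0 !mulr0 addr0 mulr0 add0r.
  - rewrite add0r.
    (* Below the diagonal [k - l >= 1]: in coordinates scaled by [eta ^+ k] and [eta ^+ l], the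
       coupling keeps the factor [eta ^+ (k - l) = eta * q]. *)
    pose d := (k - l.+1)%N.
    pose q := eta ^+ d.
    have q0 : 0 <= q by apply: exprn_ge0; exact: ltW.
    have q1 : q <= 1 by apply: exprn_ile1 => //; exact: ltW.
    have ek : eta ^+ k = eta * q * eta ^+ l.
      by rewrite -exprS -exprD; congr (_ ^+ _); rewrite /d -subSn// subSS subnK// ltnW.
    set X := eta ^+ k * x k 0; set Y := eta ^+ k * y k 0.
    set Z := eta ^+ l * x l 0; set V := eta ^+ l * y l 0.
    have -> : E k + E l = (X ^+ 2 + Y ^+ 2) + (Z ^+ 2 + V ^+ 2).
      by rewrite /E /csq /X /Y /Z /V; ring.
    have -> : (eta ^+ k) ^+ 2 * (x k 0 * (S k l * x l 0 - T k l * y l 0)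
                + y k 0 * (S k l * y l 0 + T k l * x l 0)) =
      (eta * q) * (S k l * (X * Z + Y * V) + T k l * (Y * Z - X * V)).
      by rewrite /X /Y /Z /V {1}expr2 {2}ek; ring.
    rewrite -[eta * M / 2]mulrA -!(mulrA eta) ler_pM2l//.
    set w := (X ^+ 2 + Y ^+ 2) + (Z ^+ 2 + V ^+ 2).
    have w0 : 0 <= w by rewrite !addr_ge0 ?sqr_ge0.
    have h1 : `|X * Z + Y * V| <= w / 2.
      rewrite ler_norml /w; apply/andP; split.
        have := sqr_ge0 (X + Z); have := sqr_ge0 (Y + V); rewrite !sqrrD; lra.
      have := sqr_ge0 (X - Z); have := sqr_ge0 (Y - V); rewrite !sqrrB; lra.
    have h2 : `|Y * Z - X * V| <= w / 2.
      rewrite ler_norml /w; apply/andP; split.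
        have := sqr_ge0 (Y + Z); have := sqr_ge0 (X - V); rewrite sqrrB sqrrD; lra.
      have := sqr_ge0 (Y - Z); have := sqr_ge0 (X + V); rewrite sqrrB sqrrD; lra.
    have h3 : S k l * (X * Z + Y * V) + T k l * (Y * Z - X * V) <= M / 2 * w.
      apply: le_trans (ler_norm _) _; apply: le_trans (ler_normD _ _) _.
      rewrite !normrM; apply: (@le_trans _ _ ((`|S k l| + `|T k l|) * (w / 2))).
        by rewrite mulrDl lerD// ler_wpM2l.
      by rewrite mulrAC -mulrA ler_wpM2r// divr_ge0.
    have h4 : 0 <= M / 2 * w by rewrite mulr_ge0 ?divr_ge0.
    by apply: le_trans (ler_wpM2l q0 h3) _; rewrite -[leRHS]mul1r ler_wpM2r.
  by move: lk; rewrite -(inj_eq val_inj) /= kl eqxx.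
apply: (@le_trans _ _ (\sum_k \sum_l ((if l == k then - mu * E k else 0) + eta * M / 2 * (E k + E l)))).
  apply: ler_sum => k _; apply: le_trans (ler_sum _ (fun l _ => term k l)).
  rewrite -mulr_sumr !mxE le_eqVlt; apply/orP; left; apply/eqP; congr (_ * _).
  rewrite big_split /= -!mulr_sumr; congr (_ * _ + _ * _).
    by rewrite -sumrB.
  by rewrite -big_split.
have -> : \sum_k \sum_l ((if l == k then - mu * E k else 0) + eta * M / 2 * (E k + E l))
   = (- mu + eta * M * n%:R) * \sum_k E k.
  under eq_bigr => k _.
    rewrite big_split/= -big_mkcond/= big_pred1_eq -mulr_sumr big_split/=.
    rewrite sumr_const card_ord.
    over.
  rewrite /= big_split/= -!mulr_sumr big_split/= sumr_const card_ord.
  set E' := \sum_k E k; rewrite sumrMnl -/E' -(mulr_natl E' n); by field.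
apply: ler_wpM2r; first by apply: sumr_ge0 => k _; exact: E0.
by move: etaM; lra.
Qed.

End lyapunov_certificate.

Lemma trig_diag_eigenvalue (F : fieldType) n (T : 'M[F]_n) i :
  is_trig_mx T -> eigenvalue T (T i i).
Proof.
move=> Ttrig; rewrite eigenvalue_root_char char_poly_trig// rootE (bigD1 i)//=.
by rewrite hornerM hornerXsubC subrr mul0r.
Qed.

Lemma eigenvalue_intertwine (F : fieldType) n (A T U : 'M[F]_n) z :
  U \in unitmx -> U *m A = T *m U -> eigenvalue T z -> eigenvalue A z.
Proof.
move=> Uu UA /eigenvalueP[v vT v0]; apply/eigenvalueP; exists (v *m U).
  by rewrite -mulmxA UA mulmxA vT scalemxAl.
by apply: contra_neq v0 => vU0; rewrite -[v](mulmxK Uu) vU0 mul0mx.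
Qed.

Lemma hurwitz_lyap_cert (R : realType) n (A : 'M[R]_n) : hurwitz A ->
  exists (P : 'M[R]_n) (a b : R), lyap_cert A P a b.
Proof.
case: n A => [|n] A Ahur.
  exists 0, 1, 1; split; rewrite ?trmx0// => x.
  by rewrite !bilE /mxdot !big_ord0 !mulr0 lexx.
pose AC := map_mx (real_complex R) A.
have [//|U Uu] := @Schur _ _ AC.
rewrite /similar_to conjumx ?unitarymx_unit// => Ttrig.
set T := _ *m invmx U in Ttrig.
have UA : U *m AC = T *m U by rewrite /T mulmxKV ?unitarymx_unit.
clearbody T.
have Tdiag i : remx T i i < 0.
  rewrite mxE; apply/Ahur/(eigenvalue_intertwine (unitarymx_unit Uu) UA).
  exact: trig_diag_eigenvalue.
have Tzero (i j : 'I_n.+1) : (i < j)%N -> remx T i j = 0 /\ immx T i j = 0.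
  by move=> ij; rewrite !mxE (is_trig_mxP Ttrig).
have [h [b [h0 b0 hb]]] := trig_weighted_decay Tzero Tdiag.
have [h1 h10 hh1] := fin_pos_lower_bound h0.
have UU := unitarymx_parts Uu.
have Ur : remx U *m A = remx T *m remx U - immx T *m immx U.
  by have := congr1 (@remx _ _ _) UA; rewrite !remxM remx_real immx_real mulmx0 subr0.
have Ui : immx U *m A = remx T *m immx U + immx T *m remx U.
  by have := congr1 (@immx _ _ _) UA; rewrite !immxM remx_real immx_real mulmx0 add0r.
pose H := diag_mx (\row_k h k).
(* The real part of [U^* H U]: on a real [x] its form is the weighted sum of the squared moduli of
   the entries of [U x]. Thus [P] is real although [U] is complex. *)
pose P := (remx U)^T *m H *m remx U + (immx U)^T *m H *m immx U.
have PE x y : bil P x y = \sum_k h k * ((remx U *m x) k 0 * (remx U *m y) k 0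
                             + (immx U *m x) k 0 * (immx U *m y) k 0).
  rewrite bilDm /bil !mulmxA -!trmx_mul -!mulmxA !mxE -big_split.
  by apply: eq_bigr => k _ /=; rewrite !mul_diag_mx !mxE; ring.
have sqE x : \sum_k csq (remx U *m x) (immx U *m x) k = mxdot x x.
  rewrite -bil1 -UU bilDm /bil !mulmxA -!trmx_mul -!mulmxA !mxE -big_split.
  by apply: eq_bigr => k _ /=; rewrite !mxE /csq !mxE !expr2.
have csq0 x k : 0 <= csq (remx U *m x) (immx U *m x) k.
  by rewrite addr_ge0 ?sqr_ge0.
have Ple x : h1 * mxdot x x <=
    \sum_k h k * csq (remx U *m x) (immx U *m x) k.
  by rewrite -sqE mulr_sumr; apply: ler_sum => k _; rewrite ler_wpM2r.
exists P, h1, (b * h1); split => //.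
- exact: mulr_gt0.
- by rewrite /P linearD/= !trmx_mul !trmxK tr_diag_mx !mulmxA.
move=> x; split.
  apply: le_trans (Ple x) _; rewrite PE le_eqVlt; apply/orP; left; apply/eqP.
  by apply: eq_bigr => k _; rewrite /csq !expr2.
rewrite PE !mulmxA Ur Ui mulmxBl mulmxDl -!mulmxA.
apply: le_trans (hb _ _) _.
by rewrite !mulNr lerN2 -mulrA ler_pM2l.
Qed.

Section real_eigenpairs.
Context {R : realType} {n : nat}.
Implicit Types (A P : 'M[R]_n) (x y : 'cV[R]_n).

Lemma mxdot_gt0 x : x != 0 -> 0 < mxdot x x.
Proof.
move=> x0; rewrite -frob_sqr exprn_gt0// lt_neqAle frob_ge0 andbT eq_sym.
by apply: contra_neq x0; exact: frob0_eq0.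
Qed.

(** The real and imaginary parts of [A v = z v] for [v = x + i y], so that eigenvectors can be
    inserted into real quadratic forms. *)
Definition eigenpair A (z : R[i]) x y : Prop :=
  [/\ x != 0 \/ y != 0,
      A *m x = complex.Re z *: x - complex.Im z *: y &
      A *m y = complex.Im z *: x + complex.Re z *: y].

Lemma eigenvalue_real_pair A z : eigenvalue (map_mx (real_complex R) A) z ->
  exists x y, eigenpair A z x y.
Proof.
(* [eigenvalue] speaks of row vectors; transposing first yields a column eigenvector of [A]. *)
have -> : eigenvalue (map_mx (real_complex R) A) z =
    eigenvalue (map_mx (real_complex R) A)^T z.
  rewrite /eigenvalue /eigenspace !kermx_eq0 !row_free_unit -unitmx_tr.
  by rewrite linearB/= tr_scalar_mx.
move=> /eigenvalueP[v vA v0]; set AC := map_mx _ A in vA.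
have {}vA : AC *m v^T = z%:M *m v^T.
  by rewrite mul_scalar_mx -[AC]trmxK -trmx_mul vA linearZ.
have zr : remx (z%:M : 'M[R[i]]_n) = (complex.Re z)%:M.
  by apply/matrixP => i j; rewrite !mxE; case: eqP.
have zi : immx (z%:M : 'M[R[i]]_n) = (complex.Im z)%:M.
  by apply/matrixP => i j; rewrite !mxE; case: eqP.
exists (remx v^T), (immx v^T); split.
- have [r0|] := eqVneq (remx v^T) 0; last by left.
  right; apply: contra_neq v0 => i0; apply: trmx_inj; rewrite trmx0.
  by apply: complex_mx_eq; rewrite ?r0 ?i0; apply/matrixP => i j; rewrite !mxE.
- have := congr1 (@remx _ _ _) vA.
  by rewrite !remxM remx_real immx_real mul0mx subr0 zr zi !mul_scalar_mx.
- have := congr1 (@immx _ _ _) vA.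
  by rewrite !immxM remx_real immx_real mul0mx addr0 zr zi !mul_scalar_mx addrC.
Qed.

(** The cross terms in [Im z] cancel because [P] is symmetric. *)
Lemma eigenpair_bil A z x y P : P^T = P -> eigenpair A z x y ->
  bil P x (A *m x) + bil P y (A *m y) =
  complex.Re z * (bil P x x + bil P y y).
Proof.
move=> Ps [_ -> ->]; rewrite !bilDr bilNr !bilZr (bil_sym y x Ps); ring.
Qed.

Lemma lyap_cert_hurwitz A P a b : lyap_cert A P a b -> hurwitz A.
Proof.
move=> [a0 b0 Ps Pab] z /eigenvalue_real_pair[x [y xy]].
have e := eigenpair_bil Ps xy.
have [px dx] := Pab x; have [py dy] := Pab y.
have n0 : 0 < mxdot x x + mxdot y y.
  case: xy => -[/mxdot_gt0 h _ _|/mxdot_gt0 h _ _].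
    by rewrite ltr_wpDr// mxdot_ge0.
  by rewrite ltr_wpDl// mxdot_ge0.
have q0 : 0 < bil P x x + bil P y y.
  by apply: lt_le_trans (lerD px py); rewrite -mulrDr mulr_gt0.
have : complex.Re z * (bil P x x + bil P y y) < 0.
  rewrite -e; apply: le_lt_trans (lerD dx dy) _.
  by rewrite -mulrDr mulNr oppr_lt0 mulr_gt0.
by rewrite pmulr_llt0.
Qed.

End real_eigenpairs.

(** * Positive semidefinite matrices and traces *)

Section positive_semidefinite.
Context {R : realType} {n : nat}.
Implicit Types (M P S : 'M[R]_n) (x y : 'cV[R]_n).

Definition psd P : Prop := P^T = P /\ forall x, 0 <= bil P x x.

Lemma posdef_psd P : posdef P -> psd P.
Proof.
move=> [Ps Pp]; split=> // x; have [->|x0] := eqVneq x 0; last exact/ltW/Pp.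
by rewrite /bil mulmx0 mxE.
Qed.

Lemma psd_diag_ge0 P i : psd P -> 0 <= P i i.
Proof. by move=> [_ /(_ (delta_mx i 0))]; rewrite bil_delta. Qed.

(** The forms at [e_i + e_j] and [e_i - e_j] are nonnegative, so twice the modulus of an entry is at
    most the sum of two diagonal entries. *)
Lemma psd_entry_le_trace P i j : psd P -> `|P i j| <= \tr P.
Proof.
move=> Pp; have Ptr k : P k k <= \tr P.
  rewrite /mxtrace (bigD1 k)//= lerDl; apply: sumr_ge0 => l _.
  exact: psd_diag_ge0.
have [Ps P0] := Pp.
have := P0 (delta_mx i 0 + delta_mx j 0); have := P0 (delta_mx i 0 - delta_mx j 0).
rewrite !(bilDl, bilDr, bilNl, bilNr) !bil_delta -{3 7}Ps [P^T j i]mxE.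
move: (Ptr i) (Ptr j); rewrite ler_norml; move=> *; apply/andP; split; lra.
Qed.

Lemma mxtrace_bil_rows P (V : 'M[R]_n) (e : 'rV[R]_n) :
  \tr (P *m (V^T *m diag_mx e *m V)) =
  \sum_k e 0 k * bil P (row k V)^T (row k V)^T.
Proof.
rewrite !mulmxA mxtrace_mulC !mulmxA mxtrace_mulC /mxtrace.
apply: eq_bigr => k _; rewrite mul_diag_mx mxE [in RHS]/bil trmxK; congr (_ * _).
by rewrite -row_mul [LHS]mxE [RHS]mxE; apply: eq_bigr => l _; rewrite [row _ _ _ _]mxE ![_^T _ _]mxE [row _ _ _ _]mxE.
Qed.

(** In an orthonormal eigenbasis of [S] both traces are sums of the same nonnegative numbers
    [q P k], weighted by the eigenvalues in one case and by 1 in the other. Applied to the second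
    moment, this bounds the value matrix by the cost. *)
Lemma posdef_trace_coercive S : posdef S ->
  exists2 c, 0 < c & forall P, psd P -> c * \tr P <= \tr (P *m S).
Proof.
move=> [Ss Spos].
pose SC := map_mx (real_complex R) S.
have SCh : SC \is hermsymmx.
  apply/is_hermitianmxP; rewrite expr0 scale1r.
  by apply: complex_mx_eq; rewrite ?remx_adj ?immx_adj ?remx_real ?immx_real ?Ss ?trmx0 ?oppr0.
have /mxOverP spR := hermitian_spectral_diag_real SCh.
have /hermitian_normalmx/orthomx_spectralP := SCh.
have Uu := spectral_unitarymx SC.
set U := spectralmx SC in Uu *; set sp := spectral_diag SC in spR *.
move=> SE.
have {}SE : U *m SC = diag_mx sp *m U.
  by rewrite SE !mulmxA mulmxV ?mul1mx// unitarymx_unit.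
pose e : 'rV[R]_n := remx sp.
have sp0 k : complex.Im (sp 0 k) = 0 by apply: complex.complexI; exact: RIm_real.
have er : remx (diag_mx sp) = diag_mx e.
  by apply/matrixP => i j; rewrite !mxE; case: eqP.
have ei : immx (diag_mx sp) = 0.
  by apply/matrixP => i j; rewrite !mxE; case: eqP => //= _; exact: sp0.
have Ur : remx U *m S = diag_mx e *m remx U.
  have := congr1 (@remx _ _ _) SE.
  by rewrite !remxM remx_real immx_real mulmx0 er ei mul0mx !subr0.
have Ui : immx U *m S = diag_mx e *m immx U.
  have := congr1 (@immx _ _ _) SE.
  by rewrite !immxM remx_real immx_real mulmx0 er ei mul0mx add0r addr0.
have UU := unitarymx_parts Uu.
have UU' : remx U *m (remx U)^T + immx U *m (immx U)^T = 1%:M.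
  have /unitarymxP/(congr1 (@remx _ _ _)) := Uu.
  rewrite remxM remx_adj immx_adj mulmxN opprK => ->.
  by apply/matrixP => i j; rewrite !mxE; case: eqP.
pose q P k := bil P (row k (remx U))^T (row k (remx U))^T
            + bil P (row k (immx U))^T (row k (immx U))^T.
have trPS P : \tr (P *m S) = \sum_k e 0 k * q P k.
  rewrite -[S]mul1mx -UU mulmxDl -!mulmxA Ur Ui mulmxDr linearD/= !(mulmxA _ (diag_mx e)).
  by rewrite !mxtrace_bil_rows -big_split; apply: eq_bigr => k _; rewrite mulrDr.
have trP P : \tr P = \sum_k q P k.
  have E1 (V : 'M[R]_n) : V^T *m V = V^T *m diag_mx (const_mx 1) *m V.
    by rewrite diag_const_mx mulmx1.
  rewrite -{1}[P]mulmx1 -UU mulmxDr linearD/= !E1.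
  rewrite !mxtrace_bil_rows -big_split; apply: eq_bigr => k _.
  by rewrite mxE !mul1r.
have e0 k : 0 < e 0 k.
  have rowS (V : 'M[R]_n) : V *m S = diag_mx e *m V ->
      bil S (row k V)^T (row k V)^T = e 0 k * mxdot (row k V)^T (row k V)^T.
    move=> VS; rewrite /bil trmxK -row_mul VS -bil1 /bil mulmx1 trmxK.
    rewrite row_mul row_diag_mx -scalemxAl -rowE -scalemxAl mxE //.
  have n1 : mxdot (row k (remx U))^T (row k (remx U))^T
          + mxdot (row k (immx U))^T (row k (immx U))^T = 1.
    have /matrixP/(_ k k) := UU'; rewrite !mxE eqxx => h; apply: etrans h.
    rewrite /mxdot; congr (_ + _); apply: eq_bigr => l _;
      by rewrite big_ord1 !mxE.
  have : 0 < q S k.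
    have [r0|r0] := eqVneq (row k (remx U))^T 0.
      have [i0|i0] := eqVneq (row k (immx U))^T 0.
        move: n1; rewrite r0 i0 -!bil1 /bil !mulmx0 !mxE => /eqP.
        by rewrite addr0 eq_sym oner_eq0.
      by rewrite /q r0 {1}/bil mulmx0 mxE add0r; exact: Spos.
    rewrite ltr_wpDr//; last exact: Spos.
    exact: (posdef_psd (conj Ss Spos)).2.
  by rewrite /q !rowS// -mulrDr n1 mulr1.
have [c c0 ce] := fin_pos_lower_bound e0.
exists c => // P [Ps P0]; rewrite trPS trP mulr_sumr.
by apply: ler_sum => k _; rewrite ler_wpM2r// addr_ge0.
Qed.

End positive_semidefinite.

(** * Matrix exponentials and trajectories *)

Lemma mx_cvg (R : realType) m n (u : nat -> 'M[R]_(m, n)) (L : 'M[R]_(m, n)) :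
  (forall i j, u k i j @[k --> \oo] --> L i j) -> u @ \oo --> L.
Proof.
move=> uL; apply/cvg_ballP => e e0.
have : \forall k \near \oo, forall i j, ball (L i j) e (u k i j).
  apply: filter_forall => i; apply: filter_forall => j.
  by have /cvg_ballP := uL i j; apply.
by apply: filterS => k uk; split.
Qed.

Lemma expr_scalemx (R : realType) n (A : 'M[R]_n) (t : R) k :
  (t *: A) ^+ k = t ^+ k *: A ^+ k.
Proof.
elim: k => [|k IH]; first by rewrite !expr0 scale1r.
rewrite !exprS IH -[LHS]/((t *: A) *m (t ^+ k *: A ^+ k)).
by rewrite -scalemxAl -scalemxAr scalerA.
Qed.

Section matrix_exponential.
Context {R : realType} {n : nat}.
Implicit Types A B : 'M[R]_n.

Lemma coord_expr_bound A k i j : `|(A ^+ k) i j| <= (n%:R * `|A|) ^+ k.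
Proof.
elim: k i j => [|k IH] i j.
  by rewrite !expr0 mxE; case: (i == j); rewrite ?normr1 ?normr0.
rewrite exprS mxE; apply: le_trans (ler_norm_sum _ _ _) _.
rewrite exprS -mulrA mulr_natl -[X in _ *+ X]card_ord -sumr_const.
by apply: ler_sum => l _; rewrite normrM ler_pM// coord_le_mxnorm.
Qed.

(** The left factor [B] keeps the family closed under differentiation: deriving the series replaces
    [B] by [B *m A]. *)
Definition expmx_coef B A i j : R^nat := fun k => k`!%:R^-1 * (B *m A ^+ k) i j.

(** Dominated by a multiple of the exponential series at [n |A| |t|]. *)
Lemma is_cvg_expmx_coef B A i j t : cvgn (pseries (expmx_coef B A i j) t).
Proof.
apply: normed_cvg.
pose a := n%:R * `|A|; pose b := n%:R * `|B|.
have a0 : 0 <= a by rewrite mulr_ge0.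
have b0 : 0 <= b by rewrite mulr_ge0.
apply: (@series_le_cvg R _ (fun k => b * exp_coeff (a * `|t|) k)).
- by move=> k; rewrite normr_ge0.
- move=> k; apply: mulr_ge0 => //; rewrite /exp_coeff /= mulr_ge0 ?invr_ge0//.
  by rewrite exprn_ge0// mulr_ge0.
- move=> k /=; rewrite /expmx_coef !normrM normfV normr_nat /exp_coeff/=.
  rewrite mulrA -mulrA (mulrC _^-1) ler_pM//.
    rewrite normrX exprMn mulrA ler_wpM2r ?exprn_ge0//.
    rewrite mxE; apply: le_trans (ler_norm_sum _ _ _) _.
    rewrite -mulrA mulr_natl -[X in _ *+ X]card_ord -sumr_const.
    apply: ler_sum => l _; rewrite normrM ler_pM// ?coord_le_mxnorm//.
    exact: coord_expr_bound.
- exact/(@is_cvg_seriesZ _ _ b)/is_cvg_series_exp_coeff.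
Qed.

Lemma expmxE A t i j :
  expmx (t *: A) i j = limn (pseries (expmx_coef 1%:M A i j) t).
Proof.
pose L : 'M[R]_n := \matrix_(i, j) limn (pseries (expmx_coef 1%:M A i j) t).
have : series (fun k => k`!%:R^-1 *: ((t *: A) ^+ k)) @ \oo --> L.
  apply: mx_cvg => i' j'; rewrite mxE.
  rewrite [X in X @ _](_ : _ = pseries (expmx_coef 1%:M A i' j') t).
    exact: is_cvg_expmx_coef.
  apply/funext => k.
  rewrite /pseries /series /= summxE; apply: eq_bigr => l _.
  by rewrite mxE expr_scalemx mxE /expmx_coef mul1mx mulrAC mulrA.
by move=> /cvg_lim h; rewrite /expmx h// mxE.
Qed.

Lemma mul_expmxE B A t i j :
  (B *m expmx (t *: A)) i j = limn (pseries (expmx_coef B A i j) t).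
Proof.
apply/esym/cvg_lim => //; rewrite mxE.
rewrite (_ : pseries _ t = fun k => \sum_l B i l * pseries (expmx_coef 1%:M A l j) t k).
  apply: cvg_big => [|l _]; first exact: add_continuous.
  rewrite expmxE; apply: cvgMl_tmp.
  exact: is_cvg_expmx_coef.
apply/funext => k; rewrite /pseries /series /=.
under [RHS]eq_bigr do rewrite mulr_sumr.
rewrite exchange_big /=; apply: eq_bigr => l _.
rewrite /expmx_coef mxE mulr_sumr mulr_suml; apply: eq_bigr => h _.
by rewrite mul1mx; ring.
Qed.

Lemma is_derive_mul_expmx B A i j t :
  is_derive t (1 : R) (fun t => (B *m expmx (t *: A)) i j)
    ((B *m A *m expmx (t *: A)) i j).
Proof.
have diffs B' : pseries_diffs (expmx_coef B' A i j) = expmx_coef (B' *m A) A i j.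
  apply/funext => k; rewrite /pseries_diffs /expmx_coef mulrA -mulmxA.
  by rewrite factS natrM invfM mulVKf ?pnatr_eq0// exprS.
rewrite mul_expmxE (_ : (fun t => _) = (fun t => limn (pseries (expmx_coef B A i j) t))).
  rewrite -diffs; apply: (@pseries_snd_diffs _ _ (`|t| + 1)).
  - exact: is_cvg_expmx_coef.
  - by rewrite diffs; exact: is_cvg_expmx_coef.
  - by rewrite !diffs; exact: is_cvg_expmx_coef.
  - by rewrite [ltRHS]ger0_norm// ltrDl.
by apply/funext => s; exact: mul_expmxE.
Qed.

Lemma expmx_tr A t : expmx (t *: A^T) = (expmx (t *: A))^T.
Proof.
apply/matrixP => i j; rewrite mxE !expmxE; congr (limn (pseries _ t)).
apply/funext => k; rewrite /expmx_coef !mul1mx; congr (_ * _).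
suff -> : A^T ^+ k = (A ^+ k)^T by rewrite mxE.
elim: k {i j} => [|k IH]; first by rewrite !expr0 trmx1.
by rewrite exprS IH exprSr [RHS]trmx_mul.
Qed.

Lemma expmx0 A : expmx (0 *: A) = 1%:M.
Proof.
apply/matrixP => i j; rewrite expmxE; apply: cvg_lim => //.
rewrite -(cvg_shiftS (pseries _ _)) (_ : (fun k => _) = cst ((1%:M : 'M[R]_n) i j)).
  exact: cvg_cst.
apply/funext => k; rewrite /pseries /series /= big_nat_recl//= expr0 mulr1.
rewrite big1 ?addr0; last by move=> l _; rewrite exprS mul0r mulr0.
by rewrite /expmx_coef expr0 mulmx1 fact0 invr1 mul1r.
Qed.

End matrix_exponential.

Section trajectories.
Context {R : realType} {n : nat}.
Implicit Types (A Z P : 'M[R]_n) (u v x : 'cV[R]_n).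

Lemma is_derive_fsum k (h : 'I_k -> R -> R) (t : R) (dh : 'I_k -> R) :
  (forall i, is_derive t (1 : R) (h i) (dh i)) ->
  is_derive t (1 : R) (fun s => \sum_i h i s) (\sum_i dh i).
Proof.
move=> hd; rewrite (_ : (fun s => _) = \sum_(i < k) h i); first exact: is_derive_sum.
by apply/funext => s; rewrite fct_sumE.
Qed.

Lemma is_derive_traj A v i t :
  is_derive t (1 : R) (fun s => (expmx (s *: A) *m v) i 0)
    ((A *m (expmx (t *: A) *m v)) i 0).
Proof.
rewrite (_ : (fun s => _) = (fun s => \sum_j (1%:M *m expmx (s *: A)) i j * v j 0)); last first.
  by apply/funext => s; rewrite mul1mx mxE.
rewrite mulmxA mxE; apply: is_derive_fsum => j.
have h := is_derive_mul_expmx 1%:M A i j t.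
have := @is_deriveM _ _ _ (cst (v j 0)) _ _ _ _ h (is_derive_cst (v j 0) t 1).
by move=> h'; apply: is_derive_eq h' _; rewrite scaler0 add0r mul1mx [LHS]mulrC.
Qed.

(** Product rule. The Lyapunov operator appears as the derivative of a form along trajectories, so
    sign conditions on it become monotonicity in time. *)
Lemma is_derive_bil_traj A Z u v t :
  is_derive t (1 : R)
    (fun s => bil Z (expmx (s *: A) *m u) (expmx (s *: A) *m v))
    (bil (A^T *m Z + Z *m A) (expmx (t *: A) *m u) (expmx (t *: A) *m v)).
Proof.
rewrite (_ : (fun s => _) = (fun s => \sum_i \sum_j
   (expmx (s *: A) *m u) i 0 * Z i j * (expmx (s *: A) *m v) j 0)); last first.
  by apply/funext => s; rewrite bilE.
rewrite bilDm -bil_mull -bil_mulr !bilE -big_split /=; apply: is_derive_fsum => i.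
rewrite -big_split /=; apply: is_derive_fsum => j.
have hu := is_derive_traj A u i t.
have hv := is_derive_traj A v j t.
have h1 := is_deriveM hu (is_derive_cst (Z i j) t 1).
apply: is_derive_eq (is_deriveM h1 hv) _.
by rewrite !fctE /cst /GRing.scale /=; ring.
Qed.

Lemma is_derive_continuous (f : R -> R) (df : R -> R) :
  (forall t, is_derive t (1 : R) f (df t)) -> continuous f.
Proof.
by move=> fd t; apply/differentiable_continuous/derivable1_diffP; case: (fd t).
Qed.

Lemma mxnorm_bil_bound Z : exists2 c, 0 < c &
  forall x y, `|bil Z x y| <= c * (frob x * frob y).
Proof.
exists (`|Z| * (n * n)%:R + 1); first by rewrite ltr_wpDl// mulr_ge0.
move=> x y; apply: le_trans (bil_entry_bound x y (coord_le_mxnorm Z)) _.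
by rewrite ler_wpM2r ?mulr_ge0 ?frob_ge0// lerDl.
Qed.

(* [V t (1 + k t)] is nonincreasing for the Lyapunov function [V]. *)
Lemma lyap_cert_decay A P a b : lyap_cert A P a b -> exists2 k, 0 < k &
  forall v, exists c, forall t, 0 <= t ->
    frob (expmx (t *: A) *m v) ^+ 2 <= c / (1 + k * t).
Proof.
move=> [a0 b0 Ps Pab]; have [c c0 Pc] := mxnorm_bil_bound P.
(* From [V <= c |x|^2] this [k] gives [k V <= 2 b |x|^2 <= - V'], so the derivative
   [k V + (1 + k t) V'] is nonpositive. *)
pose k := 2 * b / c; have k0 : 0 < k by rewrite divr_gt0// mulr_gt0.
exists k => // v; exists (bil P v v / a) => t t0.
pose x s := expmx (s *: A) *m v.
pose V s := bil P (x s) (x s).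
pose w s := V s * (1 + k * s).
have V0 s : 0 <= V s.
  by apply: le_trans (Pab (x s)).1; rewrite mulr_ge0 ?mxdot_ge0 ?ltW.
have dV s : is_derive s (1 : R) V (2 * bil P (x s) (A *m x s)).
  apply: is_derive_eq (is_derive_bil_traj A P v v s) _.
  by rewrite bilDm -bil_mull -bil_mulr (bil_sym (A *m _) _ Ps) -/(x s); ring.
have dl s : is_derive s (1 : R) (fun s => 1 + k * s) k.
  have := is_deriveD (is_derive_cst (1 : R) s 1) (is_deriveZ k (is_derive_id s 1)).
  by move=> h; apply: is_derive_eq h _; rewrite add0r [LHS]mulr1.
have dw s : is_derive s (1 : R) w (V s * k + (1 + k * s) * (2 * bil P (x s) (A *m x s))).
  exact: is_deriveM (dV s) (dl s).
have wdec : w t <= w 0.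
  apply: (@ler0_derive1_nincry _ w 0) => //.
  - move=> s; rewrite in_itv/= andbT => s0.
    rewrite derive1E (@derive_val _ _ _ _ _ _ _ (dw s)).
    have h1 := (Pab (x s)).2.
    have h2 : V s <= c * mxdot (x s) (x s).
      by apply: le_trans (ler_norm _) _; rewrite -frob_sqr expr2; exact: Pc.
    have h3 : V s * k <= 2 * b * mxdot (x s) (x s).
      apply: le_trans (ler_wpM2r (ltW k0) h2) _.
      by rewrite /k mulrAC mulrCA mulfV ?gt_eqF// mulr1.
    have h4 : (1 + k * s) * (2 * bil P (x s) (A *m x s)) <= 1 * (2 * bil P (x s) (A *m x s)).
      apply: ler_wnM2r; last by rewrite lerDl mulr_ge0// ltW.
      rewrite pmulr_rle0//; apply: le_trans h1 _.
      by rewrite mulNr oppr_le0 mulr_ge0 ?mxdot_ge0 ?ltW.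
    by move: h1 h3 h4; rewrite mul1r mulNr; lra.
  - exact/continuous_subspaceT/(is_derive_continuous dw).
have kt : 0 < 1 + k * t by rewrite ltr_wpDr// mulr_ge0// ltW.
rewrite ler_pdivlMr// ler_pdivlMr// mulrAC; apply: le_trans (_ : w t <= _).
  by rewrite ler_wpM2r ?(ltW kt)// mulrC frob_sqr; exact: (Pab _).1.
by apply: le_trans wdec _; rewrite /w /V /x expmx0 mul1mx mulr0 addr0 mulr1.
Qed.

Lemma bil_traj_cvg0 A P a b Z u v : lyap_cert A P a b ->
  bil Z (expmx (t *: A) *m u) (expmx (t *: A) *m v) @[t --> +oo] --> 0.
Proof.
move=> /lyap_cert_decay[k k0 dec]; have [cu hu] := dec u; have [cv hv] := dec v.
have [c c0 Zc] := mxnorm_bil_bound Z.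
apply/cvgr0Pnorm_le => e e0.
pose d := c * (`|cu| + `|cv|).
near=> t.
have t0 : 0 <= t by near: t; exact: nbhs_pinfty_ge.
have kt : 0 < 1 + k * t by rewrite ltr_wpDr// mulr_ge0// ltW.
apply: le_trans (Zc _ _) _.
set x := frob _; set y := frob _.
have xy : x * y <= x ^+ 2 + y ^+ 2.
  have := sqr_ge0 (x - y); have := sqr_ge0 (x + y); rewrite sqrrB sqrrD; lra.
apply: le_trans (ler_wpM2l (ltW c0) xy) _.
have h : x ^+ 2 + y ^+ 2 <= (`|cu| + `|cv|) / (1 + k * t).
  rewrite mulrDl lerD//.
    by apply: le_trans (hu _ t0) _; rewrite ler_wpM2r ?invr_ge0 ?(ltW kt)// ler_norm.
  by apply: le_trans (hv _ t0) _; rewrite ler_wpM2r ?invr_ge0 ?(ltW kt)// ler_norm.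
apply: le_trans (ler_wpM2l (ltW c0) h) _.
rewrite mulrA ler_pdivrMr// -/d.
have : d / e / k <= t by near: t; apply: nbhs_pinfty_ge; rewrite num_real.
rewrite ler_pdivrMr// ler_pdivrMr// => h'; move: h' e0; lra.
Unshelve. all: by end_near. Qed.

(* Along a trajectory the form of [Z] is nonincreasing and tends to [0]. *)
Lemma lyap_ineq_psd A P a b Z : lyap_cert A P a b ->
  (forall x, bil (A^T *m Z + Z *m A) x x <= 0) -> forall x, 0 <= bil Z x x.
Proof.
move=> cert Zneg x.
pose w t := bil Z (expmx (t *: A) *m x) (expmx (t *: A) *m x).
have dw t := is_derive_bil_traj A Z x x t.
have -> : bil Z x x = w 0 by rewrite /w expmx0 mul1mx.
have w0 : w t @[t --> +oo] --> 0 by exact: bil_traj_cvg0 cert.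
apply: (cvgr_to_le w0).
near=> t; apply: (@ler0_derive1_nincry _ w 0) => //.
- move=> s _; rewrite derive1E (@derive_val _ _ _ _ _ _ _ (dw s)); exact: Zneg.
- exact/continuous_subspaceT/(is_derive_continuous dw).
Unshelve. all: by end_near. Qed.

(** The form of [Z] is constant along trajectories and tends to 0. This is the injectivity of the
    Lyapunov operator. *)
Lemma lyap_eq0 A P a b Z : lyap_cert A P a b ->
  A^T *m Z + Z *m A = 0 -> Z = 0.
Proof.
move=> cert Z0.
apply/matrixP => i j; rewrite mxE -bil_delta.
pose w t := bil Z (expmx (t *: A) *m delta_mx i 0) (expmx (t *: A) *m delta_mx j 0).
have dw t : is_derive t (1 : R) w 0.
  apply: is_derive_eq (is_derive_bil_traj A Z _ _ t) _.
  by rewrite Z0 /bil mulmx0 mul0mx mxE.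
have wc t : w t = w 0.
  by apply: (@is_derive_0_is_cst _ w).
have -> : bil Z (delta_mx i 0) (delta_mx j 0) = w 0 by rewrite /w expmx0 !mul1mx.
have := @bil_traj_cvg0 A P a b Z (delta_mx i 0) (delta_mx j 0) cert.
rewrite (_ : (fun t => _) = cst (w 0)); last by apply/funext => t; exact: wc.
by move=> /(cvg_lim (@norm_hausdorff _ _)) <-; rewrite lim_cst.
Qed.

(** The form of [- Z] along the trajectory is a primitive of the integrand and vanishes at
    infinity. *)
Lemma traj_integral A P a b Z M x : lyap_cert A P a b ->
  A^T *m Z + Z *m A = - M -> (forall y, 0 <= bil M y y) ->
  \int[lebesgue_measure]_(t in `[0%R, +oo[)
     (bil M (expmx (t *: A) *m x) (expmx (t *: A) *m x)) = bil Z x x.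
Proof.
move=> cert ZM M0.
pose F t := bil (- Z) (expmx (t *: A) *m x) (expmx (t *: A) *m x).
have dF t : is_derive t (1 : R) F (bil M (expmx (t *: A) *m x) (expmx (t *: A) *m x)).
  apply: is_derive_eq (is_derive_bil_traj A (- Z) x x t) _.
  by rewrite mulmxN mulNmx -opprD ZM opprK.
rewrite (@Rintegral_ge0_continuous_FTC2y _ _ F 0 0) //.
- by rewrite /F expmx0 mul1mx bilNm sub0r opprK.
- apply: continuous_subspaceT.
  exact: (is_derive_continuous (is_derive_bil_traj A M x x)).
- exact: bil_traj_cvg0 cert.
- exact/cvg_at_right_filter/(is_derive_continuous dF).
- by move=> t _; rewrite derive1E (@derive_val _ _ _ _ _ _ _ (dF t)).
Qed.

End trajectories.

(** * The Lyapunov equation *)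

Lemma mxnormM (R : realType) m n p (M : 'M[R]_(m, n)) (N : 'M[R]_(n, p)) :
  `|M *m N| <= n%:R * (`|M| * `|N|).
Proof.
rewrite [leLHS]/Num.norm /= mx_normrE; apply/bigmax_leP; split.
  by rewrite !mulr_ge0.
move=> [i j] _ /=; rewrite mxE; apply: le_trans (ler_norm_sum _ _ _) _.
rewrite mulr_natl -[X in _ *+ X]card_ord -sumr_const.
by apply: ler_sum => l _; rewrite normrM ler_pM// coord_le_mxnorm.
Qed.

Lemma mxnorm_tr (R : realType) m n (M : 'M[R]_(m, n)) : `|M^T| = `|M|.
Proof.
apply/eqP; rewrite eq_le; apply/andP; split;
  rewrite [leLHS]/Num.norm /= mx_normrE; apply/bigmax_leP; split=> //= -[i j] _ /=.
  by rewrite mxE coord_le_mxnorm.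
by rewrite -[M]trmxK mxE -[leRHS](_ : `|M^T| = _) ?coord_le_mxnorm// trmxK.
Qed.

Lemma mxtrace_bound (R : realType) n (S : 'M[R]_n) :
  exists2 c, 0 <= c & forall X : 'M[R]_n, `|\tr (X *m S)| <= c * `|X|.
Proof.
exists (n%:R * (n%:R * `|S|)); first by rewrite !mulr_ge0.
move=> X; apply: le_trans (ler_norm_sum _ _ _) _.
rewrite -!mulrA mulr_natl -[X in _ *+ X]card_ord -sumr_const.
apply: ler_sum => i _; rewrite (mulrC `|S|).
exact: le_trans (coord_le_mxnorm _ _ _) (mxnormM _ _).
Qed.

Section lyapunov_equation.
Context {R : realType} {n : nat}.
Implicit Types (A E P X Y : 'M[R]_n) (x : 'cV[R]_n).

Definition lyapop A X : 'M[R]_n := A^T *m X + X *m A.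

Fact lyapop_linear A : linear (lyapop A).
Proof.
move=> a X Y; rewrite /lyapop mulmxDr mulmxDl -scalemxAr -scalemxAl scalerDr.
by rewrite addrACA.
Qed.

HB.instance Definition _ A :=
  GRing.isLinear.Build R 'M[R]_n 'M[R]_n _ (lyapop A) (lyapop_linear A).

(* The solution [X] of [A^T X + X A = - Y]; meaningful only when [lyapop A] is
   invertible, as it is for Hurwitz [A]. *)
Definition lyapsol A Y : 'M[R]_n :=
  vec_mx (mxvec (- Y) *m invmx (lin_mx (lyapop A))).

Variables (A P : 'M[R]_n) (a b : R).
Hypothesis cert : lyap_cert A P a b.

Lemma lyapop_inj X Y : lyapop A X = lyapop A Y -> X = Y.
Proof.
move=> XY; apply/eqP; rewrite -subr_eq0; apply/eqP/(lyap_eq0 cert).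
by rewrite -/(lyapop A _) linearB /= XY subrr.
Qed.

(** Uniqueness yields existence: an injective endomorphism of a finite-dimensional space has an
    invertible matrix, here in the coordinates of [mxvec]. *)
Lemma lyapsolP Y : lyapop A (lyapsol A Y) = - Y.
Proof.
have u : lin_mx (lyapop A) \in unitmx.
  rewrite -row_free_unit -kermx_eq0; apply/eqP/row_matrixP => i; rewrite row0.
  set v := row i _.
  have : v *m lin_mx (lyapop A) = 0 by rewrite -row_mul mulmx_ker row0.
  rewrite -[v]vec_mxK mul_vec_lin => /eqP; rewrite mxvec_eq0 => /eqP h.
  apply/eqP; rewrite mxvec_eq0; apply/eqP/lyapop_inj.
  by rewrite h linear0.
apply: (can_inj mxvecK); rewrite -mul_vec_lin /lyapsol vec_mxK.
by rewrite mulmxKV.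
Qed.

Lemma lyapsol_unique X Y : lyapop A X = - Y -> X = lyapsol A Y.
Proof. by move=> XY; apply: lyapop_inj; rewrite lyapsolP. Qed.

Lemma lyapsolD X Y : lyapsol A (X + Y) = lyapsol A X + lyapsol A Y.
Proof. by apply/esym/lyapsol_unique; rewrite linearD /= !lyapsolP opprD. Qed.

Lemma lyapsolZ c Y : lyapsol A (c *: Y) = c *: lyapsol A Y.
Proof. by apply/esym/lyapsol_unique; rewrite linearZ /= lyapsolP scalerN. Qed.

Lemma lyapsol_sym Y : Y^T = Y -> (lyapsol A Y)^T = lyapsol A Y.
Proof.
move=> Ys; apply: lyapsol_unique.
rewrite -[in RHS]Ys -linearN /= -lyapsolP /lyapop linearD /= !trmx_mul trmxK.
by rewrite addrC.
Qed.

Lemma lyapsol_psd Y : psd Y -> psd (lyapsol A Y).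
Proof.
move=> [Ys Y0]; split; first exact: lyapsol_sym.
apply: (lyap_ineq_psd cert) => x.
by rewrite -/(lyapop A _) lyapsolP bilNm oppr_le0.
Qed.

End lyapunov_equation.

(** * Bounds uniform under perturbation of the matrix *)

Section perturbation.
Context {R : realType} {n : nat}.
Implicit Types (A E P X Y : 'M[R]_n) (x : 'cV[R]_n).

Lemma lyap_cert_bil_lyapop A P a b x : lyap_cert A P a b ->
  bil (lyapop A P) x x = 2 * bil P x (A *m x).
Proof.
move=> [_ _ Ps _].
by rewrite bilDm -bil_mull -bil_mulr (bil_sym (A *m _) _ Ps); ring.
Qed.

(* [A'^T Z + Z A' <= 0] for [Z = beta / (2b) P -+ X]. *)
Lemma lyapsol_comparison A P a b Y (beta : R) : lyap_cert A P a b ->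
  (forall x, `|bil Y x x| <= beta * mxdot x x) ->
  forall x, `|bil (lyapsol A Y) x x| <= beta / (2 * b) * bil P x x.
Proof.
move=> cert Yb x.
have [a0 b0 Ps Pab] := cert.
have b2 : 0 < 2 * b by rewrite mulr_gt0.
have h (s : R) : `|s| = 1 ->
    0 <= bil ((beta / (2 * b)) *: P + s *: lyapsol A Y) x x.
  move=> s1; apply: (lyap_ineq_psd cert) => y; rewrite -/(lyapop A _).
  rewrite linearD !linearZ /= (lyapsolP cert) bilDm !bilZm bilNm.
  rewrite (lyap_cert_bil_lyapop _ cert) mulrN subr_le0.
  have bt0 : 0 <= beta \/ mxdot y y = 0.
    have := Yb y; have := mxdot_ge0 y; rewrite le_eqVlt => /orP[/eqP<-|y0]; first by right.
    by move=> /(le_trans (normr_ge0 _)); rewrite pmulr_lge0//; left.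
  have h1 : beta / (2 * b) * (2 * bil P y (A *m y)) <= - beta * mxdot y y.
    case: bt0 => [beta0|y0].
      apply: le_trans (ler_wpM2l (divr_ge0 beta0 (ltW b2)) (ler_wpM2l (ler0n _ 2) (Pab y).2)) _.
      rewrite le_eqVlt; apply/orP; left; apply/eqP; field.
      by rewrite gt_eqF.
    have y00 : y = 0 by apply/frob0_eq0/eqP; rewrite -sqrf_eq0 frob_sqr y0.
    by rewrite y00 /bil mulmx0 mulmx0 mxE -[X in mxdot X X](scale0r (0 : 'cV_n)) mxdotZl; lra.
  apply: le_trans h1 _.
  have := Yb y; rewrite -[X in X <= _]mul1r -s1 -normrM ler_norml => /andP[+ _].
  by rewrite mulNr.
have := h 1 (normr1 _); have := h (-1) (normrN1 _).
rewrite !bilDm !bilZm ler_norml => h1 h2; apply/andP; split; lra.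
Qed.

(** The constant is chosen before [A], so it serves all matrices sharing the certificate. Symmetry
    of [Y] makes the solution symmetric, and its entries are then recovered from its quadratic form
    by polarization. *)
Lemma lyapsol_bound P b : 0 < b -> exists2 c, 0 <= c & forall A a Y,
  lyap_cert A P a b -> Y^T = Y -> `|lyapsol A Y| <= c * `|Y|.
Proof.
move=> b0; have [d d0 Pd] := mxnorm_bil_bound P.
exists (3 * d * n%:R ^+ 2 / b); first by rewrite divr_ge0 ?(ltW b0)// !mulr_ge0 ?(ltW d0)// exprn_ge0.
move=> A a Y cert Ys; set X := lyapsol A Y.
have Xs : X^T = X by exact: (lyapsol_sym cert).
have Yb x : `|bil Y x x| <= `|Y| * n%:R ^+ 2 * mxdot x x.
  by have := bil_entry_bound x x (coord_le_mxnorm Y); rewrite -expr2 frob_sqr -natrX -mulnn.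
have Xb x : `|bil X x x| <= `|Y| * n%:R ^+ 2 / (2 * b) * (d * mxdot x x).
  apply: le_trans (lyapsol_comparison cert Yb x) _.
  rewrite ler_wpM2l//; last by rewrite -frob_sqr expr2; exact: le_trans (ler_norm _) (Pd _ _).
  by rewrite divr_ge0 ?mulr_ge0 ?exprn_ge0 ?(ltW b0).
rewrite [leLHS]/Num.norm /= mx_normrE; apply/bigmax_leP; split.
  by rewrite !mulr_ge0 ?invr_ge0 ?exprn_ge0 ?(ltW b0) ?(ltW d0).
move=> [i j] _ /=.
have e1 (k : 'I_n) : mxdot (delta_mx k 0 : 'cV[R]_n) (delta_mx k 0) = 1.
  by rewrite -bil1 bil_delta mxE eqxx.
have e2 : mxdot (delta_mx i 0 : 'cV[R]_n) (delta_mx j 0) <= 1.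
  by rewrite -bil1 bil_delta mxE; case: (i == j).
have := Xb (delta_mx i 0 + delta_mx j 0).
have := Xb (delta_mx i 0); have := Xb (delta_mx j 0).
rewrite bilDl !bilDr !mxdotE (mxdotC (delta_mx j 0)) !e1 !bil_delta (_ : X j i = X i j); last by rewrite -{1}Xs mxE.
set q := _ / (2 * b) => h1 h2 h3.
have q0 : 0 <= q by rewrite divr_ge0 ?mulr_ge0 ?exprn_ge0 ?(ltW b0).
have qd0 : 0 <= q * d by rewrite mulr_ge0 ?(ltW d0).
have h3' : `|X i i + X i j + (X i j + X j j)| <= q * d * 4.
  apply: le_trans h3 _; rewrite -mulrA ler_wpM2l// ler_wpM2l ?(ltW d0)//.
  by move: e2; lra.
(* Twice the entry [X i j] is the form at [e_i + e_j] minus two diagonal entries, hence at most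
   [4 + 1 + 1] times [q * d] in modulus. *)
have -> : 3 * d * n%:R ^+ 2 / b * `|Y| = 6 * (q * d).
  by rewrite /q; field; rewrite gt_eqF.
move: h1 h2 h3'; rewrite mulr1 !ler_norml => /andP[? ?] /andP[? ?] /andP[? ?].
apply/andP; split; lra.
Qed.

(** The difference [A' - A] spoils the form by at most [b / 2], so the same [P] stays a certificate
    on a whole ball, with half the decay. *)
Lemma lyap_cert_nbhs A P a b : lyap_cert A P a b -> exists2 rho, 0 < rho &
  forall A', `|A' - A| <= rho -> lyap_cert A' P a (b / 2).
Proof.
move=> [a0 b0 Ps Pab].
pose c := n%:R * `|P| * (n * n)%:R + 1.
have c0 : 0 < c by rewrite ltr_wpDl// !mulr_ge0.
exists (b / 2 / c); first by rewrite !divr_gt0.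
move=> A' AA'; split; rewrite ?divr_gt0// => x; split; first exact: (Pab x).1.
have -> : bil P x (A' *m x) = bil P x (A *m x) + bil (P *m (A' - A)) x x.
  by rewrite -bil_mulr -bilDr -mulmxDl addrCA subrr addr0.
have h : bil (P *m (A' - A)) x x <= b / 2 * mxdot x x.
  apply: le_trans (ler_norm _) _.
  apply: le_trans (bil_entry_bound _ _ (coord_le_mxnorm _)) _.
  rewrite -expr2 frob_sqr ler_wpM2r ?mxdot_ge0//.
  have h1 : `|P *m (A' - A)| * (n * n)%:R <= n%:R * `|P| * (n * n)%:R * `|A' - A|.
    by rewrite mulrAC ler_wpM2r// -mulrA mxnormM.
  apply: le_trans h1 _.
  move: AA'; rewrite ler_pdivlMr// => h2; apply: le_trans h2.
  by rewrite mulrC ler_wpM2l// /c lerDl.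
by have := (Pab x).2; move: h; rewrite !mulNr; lra.
Qed.

End perturbation.

(** * The cost as a function of the gain *)

Lemma borel_continuous_measurable (R : realType) m n (f : 'M[R]_(m, n) -> R) :
  continuous f -> measurable_fun setT (f : borel_mx R m n -> R).
Proof.
move=> /continuousP cf; apply: (measurability _ (RGenOpens.measurableE R)).
move=> _ [_ [a [b ->]] <-]; rewrite setTI; apply: sub_sigma_algebra.
exact/cf/interval_open.
Qed.

Section matrix_growth.
Context {R : realType} {m p : nat}.

(** The bound is global in [V], not only near 0; degrees add under products, which grades the terms
    of an expansion in [V]. *)
Definition mxnorm_order (k : nat) r s (F : 'M[R]_(m, p) -> 'M[R]_(r, s)) : Prop :=
  exists2 c, 0 <= c & forall V, `|F V| <= c * `|V| ^+ k.

Lemma mxnorm_orderM j k r s t (F : 'M[R]_(m, p) -> 'M[R]_(r, s))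
    (G : 'M[R]_(m, p) -> 'M[R]_(s, t)) :
  mxnorm_order j F -> mxnorm_order k G ->
  mxnorm_order (j + k) (fun V => F V *m G V).
Proof.
move=> [c c0 Fc] [d d0 Gd]; exists (s%:R * (c * d)); first by rewrite !mulr_ge0.
move=> V; apply: le_trans (mxnormM _ _) _; rewrite -mulrA ler_wpM2l//.
by rewrite exprD mulrACA ler_pM.
Qed.

Lemma mxnorm_order_cst r s (M : 'M[R]_(r, s)) : mxnorm_order 0 (fun=> M).
Proof. by exists `|M| => // V; rewrite mulr1. Qed.

Lemma mxnorm_order_id : mxnorm_order 1 id.
Proof. by exists 1 => // V; rewrite mul1r. Qed.

Lemma mxnorm_order_tr k r s (F : 'M[R]_(m, p) -> 'M[R]_(r, s)) :
  mxnorm_order k F -> mxnorm_order k (fun V => (F V)^T).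
Proof. by move=> [c c0 Fc]; exists c => // V; rewrite mxnorm_tr. Qed.

Lemma mxnorm_orderN k r s (F : 'M[R]_(m, p) -> 'M[R]_(r, s)) :
  mxnorm_order k F -> mxnorm_order k (fun V => - F V).
Proof. by move=> [c c0 Fc]; exists c => // V; rewrite normrN. Qed.

Lemma mxnorm_orderD k r s (F G : 'M[R]_(m, p) -> 'M[R]_(r, s)) :
  mxnorm_order k F -> mxnorm_order k G -> mxnorm_order k (fun V => F V + G V).
Proof.
move=> [c c0 Fc] [d d0 Gd]; exists (c + d); first exact: addr_ge0.
by move=> V; apply: le_trans (ler_normD _ _) _; rewrite mulrDl lerD.
Qed.

End matrix_growth.

Section cost_formula.
Context {R : realType} {n m p : nat}.
Variables (A : 'M[R]_n) (B : 'M[R]_(n, m)) (C : 'M[R]_(p, n)).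
Variables (Q : 'M[R]_p) (W : 'M[R]_m).
Hypotheses (hQ : posdef Q) (hW : posdef W).
Variable D : probability (borel_mx R n 1) R.
Variable Pmax : R.
Hypothesis hbounded : {ae D, forall x, frob (x : 'cV[R]_n) <= Pmax}.
Implicit Type K V : 'M[R]_(m, p).

Local Notation AK := (closed_loop A B C).
Local Notation S := (stabilizing A B C).
Local Notation Sigma := (second_moment D).

Definition stage_cost K : 'M[R]_n := C^T *m (Q + K^T *m W *m K) *m C.

Lemma stage_costE K x :
  bil (stage_cost K) x x = bil Q (C *m x) (C *m x) + bil W (K *m (C *m x)) (K *m (C *m x)).
Proof.
by rewrite /stage_cost /bil mulmxDr !mulmxDl mulmxDr mulmxDl mxE !trmx_mul !mulmxA.
Qed.

Lemma stage_cost_psd K : psd (stage_cost K).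
Proof.
have [[Qs _] [Ws _]] := (hQ, hW); split=> [|x].
  by rewrite /stage_cost !trmx_mul linearD /= !trmx_mul !trmxK Qs Ws !mulmxA.
by rewrite stage_costE addr_ge0//; [case: (posdef_psd hQ)|case: (posdef_psd hW)].
Qed.

Definition value_mx K : 'M[R]_n := lyapsol (AK K) (stage_cost K).

Lemma trajectory_costE K x : S K ->
  trajectory_cost A B C Q W K x = bil (value_mx K) x x.
Proof.
move=> /hurwitz_lyap_cert[P [a [b cert]]].
rewrite -(traj_integral x cert (lyapsolP cert (stage_cost K)) (stage_cost_psd K).2).
rewrite /trajectory_cost /Rintegral; congr fine; apply: eq_integral => t _.
by congr (_%:E); rewrite /bil /stage_cost expmx_tr trmx_mul !mulmxA.
Qed.

(** The product is almost surely bounded by [Pmax ^+ 2]. *)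
Lemma integrable_coord_prod (i j : 'I_n) :
  D.-integrable setT (fun x : 'cV[R]_n => (x i 0 * x j 0)%:E).
Proof.
have mc k : measurable_fun setT (fun x : borel_mx R n 1 => (x : 'cV[R]_n) k 0).
  apply: (@borel_continuous_measurable R n 1 (fun x => x k 0)).
  exact: coord_continuous.
apply/integrableP; split; first exact/measurable_EFinP/measurable_funM.
apply: (@le_lt_trans _ _ (\int[D]_x (Pmax ^+ 2)%:E)%E); last first.
  by rewrite integral_cst//= probability_setT mule1 ltry.
apply: ae_ge0_le_integral => //.
- by apply: measurableT_comp => //; exact/measurable_EFinP/measurable_funM.
- by move=> x _; rewrite lee_fin sqr_ge0.
have [Z [mZ Z0 ZP]] := hbounded; exists Z; split=> // x xh; apply: ZP => xP.
apply: xh => _; rewrite lee_fin normrM expr2.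
by apply: ler_pM => //; apply: le_trans xP; exact: coord_le_frob.
Qed.

Lemma costE K : S K -> cost A B C Q W D K = \tr (value_mx K *m Sigma).
Proof.
move=> SK; rewrite /cost unlock.
under eq_integral => x _.
  rewrite trajectory_costE// bilE.
  rewrite (_ : _%:E = \sum_i \sum_j (value_mx K i j)%:E * ((x : 'cV[R]_n) i 0 * (x : 'cV[R]_n) j 0)%:E)%E; last first.
    rewrite -sumEFin; apply: eq_bigr => i _; rewrite -sumEFin; apply: eq_bigr => j _.
    by rewrite -EFinM; congr (_%:E); ring.
  over.
have h i j : D.-integrable setT (fun x : 'cV[R]_n => (value_mx K i j)%:E * (x i 0 * x j 0)%:E)%E.
  by apply: integrableZl => //; exact: integrable_coord_prod.
rewrite integral_sum//=; last by move=> i; apply: integrable_sum => // j _; exact: h.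
rewrite (_ : \sum_i _ = (\sum_i \sum_j value_mx K i j * Sigma i j)%:E)%E.
  rewrite /mxtrace /=; apply: eq_bigr => i _; rewrite mxE; apply: eq_bigr => j _.
  by congr (_ * _); rewrite !mxE; congr (fine 'E_D[_]); apply/funext => x; rewrite mulrC.
rewrite -sumEFin; apply: eq_bigr => i _; rewrite integral_sum//=.
rewrite -sumEFin; apply: eq_bigr => j _; rewrite integralZl//; last exact: integrable_coord_prod.
rewrite EFinM; congr (_ * _)%E; rewrite [second_moment D i j]mxE fineK unlock//.
exact/integrable_fin_num/integrable_coord_prod.
Qed.

Lemma value_mx_psd K : S K -> psd (value_mx K).
Proof.
by move=> /hurwitz_lyap_cert[P [a [b cert]]]; exact/(lyapsol_psd cert)/stage_cost_psd.
Qed.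

Lemma cost_ge0 K : 0 <= cost A B C Q W D K.
Proof.
have [_ M0] := stage_cost_psd K.
rewrite /cost fine_ge0// unlock; apply: integral_ge0 => x _.
rewrite lee_fin; apply: fine_ge0; apply: integral_ge0 => t _; rewrite lee_fin.
have := M0 (expmx (t *: AK K) *m x).
by rewrite /bil /stage_cost expmx_tr trmx_mul !mulmxA.
Qed.

(** The part linear in [V] of the source in the Lyapunov equation for the change of the value
    matrix: it collects the variation of the stage cost and the effect of replacing [AK K] by
    [AK K - B *m V *m C] in the equation at [K]. *)
Definition value_pert1 K V : 'M[R]_n :=
  C^T *m (V^T *m W *m K + K^T *m W *m V) *m C
  - ((B *m V *m C)^T *m value_mx K + value_mx K *m (B *m V *m C)).

Definition value_pert2 V : 'M[R]_n := C^T *m (V^T *m W *m V) *m C.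

Lemma value_pert1_linear K a V V' :
  value_pert1 K (a *: V + V') = a *: value_pert1 K V + value_pert1 K V'.
Proof.
rewrite /value_pert1.
have -> : B *m (a *: V + V') *m C = a *: (B *m V *m C) + B *m V' *m C.
  by rewrite mulmxDr mulmxDl -scalemxAr -scalemxAl.
have -> : (a *: V + V')^T = a *: V^T + V'^T by rewrite linearP.
have -> : (a *: (B *m V *m C) + B *m V' *m C)^T =
    a *: (B *m V *m C)^T + (B *m V' *m C)^T by rewrite linearP.
rewrite !(mulmxDl, mulmxDr) -!(scalemxAl, scalemxAr).
move: (value_mx K *m _) (value_mx K *m _) (_ *m value_mx K) (_ *m value_mx K).
move: (C^T *m _ *m C) (C^T *m _ *m C) (C^T *m _ *m C) (C^T *m _ *m C).
by move=> *; apply/matrixP => i j; rewrite !mxE; ring.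
Qed.

Lemma mxnorm_value_pert2 : mxnorm_order 2 value_pert2.
Proof.
have V1 := @mxnorm_order_id R m p.
exact: mxnorm_orderM (mxnorm_orderM (mxnorm_order_cst C^T)
  (mxnorm_orderM (mxnorm_orderM (mxnorm_order_tr V1) (mxnorm_order_cst W)) V1))
  (mxnorm_order_cst C).
Qed.

Lemma mxnorm_value_pert1 K : mxnorm_order 1 (value_pert1 K).
Proof.
have V1 := @mxnorm_order_id R m p.
have BVC := mxnorm_orderM (mxnorm_orderM (mxnorm_order_cst B) V1) (mxnorm_order_cst C).
have VK := mxnorm_orderM (mxnorm_orderM (mxnorm_order_tr V1) (mxnorm_order_cst W)) (mxnorm_order_cst K).
have KV := mxnorm_orderM (mxnorm_order_cst (K^T *m W)) V1.
apply: (mxnorm_orderD (mxnorm_orderM (mxnorm_orderM (mxnorm_order_cst C^T)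
  (mxnorm_orderD VK KV)) (mxnorm_order_cst C))).
apply: mxnorm_orderN; apply: mxnorm_orderD.
  exact: mxnorm_orderM (mxnorm_order_tr BVC) (mxnorm_order_cst (value_mx K)).
exact: mxnorm_orderM (mxnorm_order_cst (value_mx K)) BVC.
Qed.

Lemma closed_loop_pert K V : AK (K + V) = AK K - B *m V *m C.
Proof. by rewrite /closed_loop mulmxDr mulmxDl opprD addrA. Qed.

(** Subtracting the two Lyapunov equations gives an exact identity: the operator is taken at [K + V]
    and the value matrix inside [value_pert1] at [K], so no remainder occurs. *)
Lemma value_mx_pert K V : S K -> S (K + V) ->
  value_mx (K + V) - value_mx K =
  lyapsol (AK (K + V)) (value_pert1 K V + value_pert2 V).
Proof.
move=> /hurwitz_lyap_cert[P [a [b cert]]] /hurwitz_lyap_cert[P' [a' [b' cert']]].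
apply: (lyapsol_unique cert').
rewrite linearB /= (lyapsolP cert') closed_loop_pert.
have := lyapsolP cert (stage_cost K); rewrite -/(value_mx K).
move=> /(congr1 (fun X => X + stage_cost K)); rewrite addNr /lyapop => e.
rewrite linearB /= mulmxBl mulmxBr -[RHS]subr0 -{}e /value_pert1 /value_pert2.
rewrite /stage_cost [(K + V)^T]linearD /=; move: (closed_loop A B C K) => AK0.
rewrite !(mulmxDl, mulmxDr).
do 12?[move: (_ *m _) => ?].
by apply/matrixP => i j; rewrite !mxE; ring.
Qed.

End cost_formula.

Section cost_regularity.
Context {R : realType} {n m p : nat}.
Variables (A : 'M[R]_n) (B : 'M[R]_(n, m)) (C : 'M[R]_(p, n)).
Variables (Q : 'M[R]_p) (W : 'M[R]_m).
Hypotheses (hQ : posdef Q) (hW : posdef W).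
Variable D : probability (borel_mx R n 1) R.
Variable Pmax : R.
Hypothesis hbounded : {ae D, forall x, frob (x : 'cV[R]_n) <= Pmax}.
Implicit Type K V : 'M[R]_(m, p).

Local Notation AK := (closed_loop A B C).
Local Notation S := (stabilizing A B C).
Local Notation Sigma := (second_moment D).
Local Notation value := (value_mx A B C Q W).
Local Notation pert1 := (value_pert1 A B C Q W).
Local Notation pert2 := (value_pert2 C W).
Local Notation f := (cost A B C Q W D).

Lemma value_pert1_sym K V : S K -> (pert1 K V)^T = pert1 K V.
Proof.
move=> SK; have [vs _] := value_mx_psd hQ hW SK; have [Ws _] := hW.
rewrite /value_pert1 linearB /= [(_ + _)^T]linearD /= !trmx_mul !trmxK vs.
rewrite [(_ + _)^T]linearD /= !trmx_mul !trmxK Ws !mulmxA.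
by rewrite [X in _ *m X *m _]addrC; congr (_ - _); rewrite addrC.
Qed.

Lemma value_pert2_sym V : (pert2 V)^T = pert2 V.
Proof.
by have [Ws _] := hW; rewrite /value_pert2 !trmx_mul !trmxK Ws !mulmxA.
Qed.

(** One [P] certifies a whole ball of gains, which makes the constant of [lyapsol_bound] uniform
    there. *)
Lemma stabilizing_local_cert K : S K -> exists rho P a b,
  [/\ 0 < rho, 0 < b & forall V, `|V| <= rho -> lyap_cert (AK (K + V)) P a b].
Proof.
move=> /hurwitz_lyap_cert[P [a [b cert]]].
have [rho rho0 near] := lyap_cert_nbhs cert.
have [c c0 cB] : mxnorm_order 1 (fun V => B *m V *m C).
  exact: mxnorm_orderM (mxnorm_orderM (mxnorm_order_cst B) (@mxnorm_order_id R m p))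
    (mxnorm_order_cst C).
have [_ b0 _ _] := cert.
have c10 : 0 < c + 1 by rewrite ltr_wpDl.
exists (rho / (c + 1)), P, a, (b / 2); split; rewrite ?divr_gt0// => V VR.
apply: near; rewrite closed_loop_pert addrAC subrr add0r normrN.
apply: le_trans (cB V) _; move: VR; rewrite ler_pdivlMr// => VR; apply: le_trans VR.
by rewrite mulrC ler_wpM2l// lerDl.
Qed.

Lemma cost_diffE K V : S K -> S (K + V) ->
  f (K + V) - f K =
  \tr (lyapsol (AK (K + V)) (pert1 K V + pert2 V) *m Sigma).
Proof.
move=> SK SV; rewrite !(costE hQ hW hbounded)// -value_mx_pert//.
by rewrite mulmxBl linearB.
Qed.

Lemma cost_locally_lipschitz K : S K -> exists rho c, [/\ 0 < rho, 0 <= c &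
  forall V, `|V| <= rho -> S (K + V) /\ `|f (K + V) - f K| <= c * `|V|].
Proof.
move=> SK; have [rho [P [a [b [rho0 b0 cert]]]]] := stabilizing_local_cert SK.
have [c c0 hc] := lyapsol_bound P b0.
have [c1 c10 h1] := mxnorm_value_pert1 A B C Q W K.
have [c2 c20 h2] := mxnorm_value_pert2 C W.
have [t t0 ht] := mxtrace_bound Sigma.
(* A radius of at most 1 lets the quadratic term be absorbed into a multiple of [|V|]. *)
exists (Num.min 1 rho), (t * (c * (c1 + c2))); split.
- by rewrite lt_min ltr01.
- by rewrite !mulr_ge0// addr_ge0.
move=> V; rewrite le_min => /andP[V1 VR].
have SV : S (K + V) by exact/lyap_cert_hurwitz/(cert _ VR).
split=> //; rewrite cost_diffE//.
apply: le_trans (ht _) _; rewrite -mulrA ler_wpM2l//.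
apply: le_trans (hc _ _ _ (cert _ VR) _) _.
  by rewrite linearD /= value_pert1_sym// value_pert2_sym.
rewrite -mulrA ler_wpM2l//; apply: le_trans (ler_normD _ _) _.
rewrite mulrDl lerD//; apply: le_trans (h2 V) _.
by rewrite ler_wpM2l// expr2 ler_piMl.
Qed.

(** The exact increment with the quadratic source dropped and the operator frozen at [K]. *)
Definition cost_slope K V : R := \tr (lyapsol (AK K) (pert1 K V) *m Sigma).

Lemma cost_slope_linear K a V V' : S K ->
  cost_slope K (a *: V + V') = a * cost_slope K V + cost_slope K V'.
Proof.
move=> /hurwitz_lyap_cert[P [c [b cert]]].
rewrite /cost_slope value_pert1_linear (lyapsolD cert) (lyapsolZ cert).
by rewrite mulmxDl -scalemxAl linearD linearZ.
Qed.

Lemma is_derive_cost_slope K V : S K -> is_derive K V f (cost_slope K V).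
Proof.
move=> SK; have [rho [P [a [b [rho0 b0 cert]]]]] := stabilizing_local_cert SK.
have [c c0 hc] := lyapsol_bound P b0.
have [t t0 ht] := mxtrace_bound Sigma.
have cert0 : lyap_cert (AK K) P a b.
  by have := cert 0; rewrite addr0 normr0; apply; exact: ltW.
have [vs _] := value_mx_psd hQ hW SK.
set X := lyapsol (AK K) (pert1 K V).
have Xs : X^T = X by apply: (lyapsol_sym cert0); exact: value_pert1_sym.
pose E := B *m V *m C.
(* Replacing [K] by [K + h *: V] changes the Lyapunov operator on [X] by [- h *: Y], so unfreezing
   the operator costs [h] times a solution with source [Y]. The quadratic source costs another
   factor [h]; both solutions are bounded through the common certificate, and the error of the
   difference quotient is [O(|h|)]. *)
pose Y := E^T *m X + X *m E.
have Ys : Y^T = Y by rewrite /Y linearD /= [(E^T *m X)^T]trmx_mul [(X *m E)^T]trmx_mul trmxK Xs addrC.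
have key h : h != 0 -> `|h *: V| <= rho ->
    `|h^-1 *: (f (h *: V + K) - f K) - cost_slope K V| <=
    t * (c * (`|pert2 V| + `|Y|)) * `|h|.
  move=> h0 hV; rewrite (addrC _ K).
  have certh := cert _ hV.
  have SV : S (K + h *: V) by exact/lyap_cert_hurwitz/certh.
  rewrite cost_diffE//.
  have -> : pert1 K (h *: V) = h *: pert1 K V.
    have z : pert1 K 0 = 0.
      have := value_pert1_linear A B C Q W K 1 0 0; rewrite !scale1r addr0.
      by rewrite -[X in X = _]addr0 => /addrI.
    by rewrite -[h *: V]addr0 value_pert1_linear z addr0.
  have -> : pert2 (h *: V) = (h * h) *: pert2 V.
    rewrite /value_pert2 [(h *: V)^T]linearZ /=.
    by rewrite !(=^~ scalemxAl, =^~ scalemxAr) scalerA.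
  rewrite (lyapsolD certh) !(lyapsolZ certh) -scalerA -scalerDr.
  rewrite -scalemxAl linearZ /= -[_ *: _]/(_ * _) mulKf//.
  have XE : lyapsol (AK (K + h *: V)) (pert1 K V) - X = - h *: lyapsol (AK (K + h *: V)) Y.
    rewrite -(lyapsolZ certh); apply: (lyapsol_unique certh).
    rewrite linearB /= (lyapsolP certh).
    have -> : lyapop (AK (K + h *: V)) X = lyapop (AK K) X - h *: Y.
      rewrite closed_loop_pert -scalemxAr -scalemxAl -/E /lyapop /Y.
      rewrite linearB /= linearZ /= mulmxBl mulmxBr -scalemxAl -scalemxAr scalerDr opprD.
      by rewrite addrACA.
    rewrite (lyapsolP cert0); move: (value_pert1 _ _ _ _ _ _ _) => N.
    by rewrite opprD !opprK addKr scaleNr opprK.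
  rewrite /cost_slope -/X -linearB /= -mulmxBl addrAC XE scaleNr addrC -scalerBr.
  rewrite -scalemxAl linearZ /= normrM mulrC ler_wpM2r//.
  apply: le_trans (ht _) _; rewrite ler_wpM2l//.
  apply: le_trans (ler_normB _ _) _; rewrite mulrDr lerD//.
    by apply: (hc _ _ _ certh); exact: value_pert2_sym.
  exact: (hc _ _ _ certh).
have cv : h^-1 *: (f (h *: V + K) - f K) @[h --> 0^'] --> cost_slope K V.
  apply/cvgrPdist_le => e e0.
  set q := t * _ in key.
  have q0 : 0 <= q by rewrite !mulr_ge0// addr_ge0.
  have q10 : 0 < q + 1 by rewrite ltr_wpDl.
  have V10 : 0 < `|V| + 1 by rewrite ltr_wpDl.
  near=> h.
  have h0 : h != 0 by near: h; exact: nbhs_dnbhs_neq.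
  rewrite distrC; apply: le_trans (key h h0 _) _.
    rewrite normrZ; have : `|h| <= rho / (`|V| + 1).
      by near: h; apply: dnbhs0_le; exact: divr_gt0.
    rewrite ler_pdivlMr// => hh; apply: le_trans hh.
    by rewrite ler_wpM2l// lerDl.
  have : `|h| <= e / (q + 1).
    by near: h; apply: dnbhs0_le; exact: divr_gt0.
  rewrite ler_pdivlMr// => hh; apply: le_trans hh.
  by rewrite mulrC ler_wpM2l// lerDl.
apply: DeriveDef; first exact: cvgP cv.
exact: cvg_lim cv.
Unshelve. all: by end_near. Qed.

(** The slope is linear in [V], hence determined by its values on the matrices [delta_mx i j], which
    are the entries of the gradient. *)
Lemma is_derive_cost K V : S K -> is_derive K V f (mxdot (gradient f K) V).
Proof.
move=> SK; apply: is_derive_eq (is_derive_cost_slope V SK) _.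
have z : cost_slope K 0 = 0.
  have := cost_slope_linear 1 0 0 SK; rewrite scale1r addr0 mul1r.
  by rewrite -[X in X = _]addr0 => /addrI.
have add V1 V2 : cost_slope K (V1 + V2) = cost_slope K V1 + cost_slope K V2.
  by rewrite -[V1]scale1r cost_slope_linear// mul1r scale1r.
rewrite {1}[V]matrix_sum_delta (big_morph _ add z); apply: eq_bigr => i _.
rewrite (big_morph _ add z); apply: eq_bigr => j _.
rewrite -[V i j *: _]addr0 cost_slope_linear// z addr0 mulrC; congr (_ * _).
by rewrite mxE (@derive_val _ _ _ _ _ _ _ (is_derive_cost_slope (delta_mx i j) SK)).
Qed.

End cost_regularity.

(** * Observability and limits of stabilizing gains *)

(** The span of [x] and [y] is stable under [A], so if [C] vanishes on it then so does every
    [C *m A ^+ k], against full column rank. *)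
Lemma observable_eigenpair (R : realType) n p (A : 'M[R]_n) (C : 'M[R]_(p, n)) z x y :
  observable A C -> eigenpair A z x y -> C *m x = 0 -> C *m y = 0 -> False.
Proof.
move=> hobs [xy Ax Ay] Cx Cy.
have CA k : C *m (A ^+ k *m x) = 0 /\ C *m (A ^+ k *m y) = 0.
  elim: k => [|k [IHx IHy]]; first by rewrite expr0 !mul1mx.
  rewrite exprSr -![A ^+ k * A *m _]mulmxA Ax Ay !(mulmxDr, mulmxN) -!scalemxAr.
  by rewrite IHx IHy !scaler0 subr0 addr0.
set M := \mxcol_(k < n) (C *m A ^+ k).
have /row_fullP[N NM] : row_full M by rewrite /row_full hobs.
have Mv v : (forall k, C *m (A ^+ k *m v) = 0) -> v = 0.
  move=> Cv; rewrite -[v]mul1mx -NM -mulmxA /M mxcol_mul.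
  by under eq_mxcol do rewrite -mulmxA Cv; rewrite mxcol0 mulmx0.
have [x0 y0] : x = 0 /\ y = 0 by split; apply: Mv => k; case: (CA k).
by case: xy; rewrite ?x0 ?y0 eqxx.
Qed.

Section sublevel_closed.
Context {R : realType} {n m p : nat}.
Variables (A : 'M[R]_n) (B : 'M[R]_(n, m)) (C : 'M[R]_(p, n)).
Variables (Q : 'M[R]_p) (W : 'M[R]_m).
Hypotheses (hQ : posdef Q) (hW : posdef W).
Variable D : probability (borel_mx R n 1) R.
Hypothesis hSigma : posdef (second_moment D).
Variable Pmax : R.
Hypothesis hbounded : {ae D, forall x, frob (x : 'cV[R]_n) <= Pmax}.
Hypothesis hobs : observable A C.
Implicit Type K V : 'M[R]_(m, p).

Local Notation AK := (closed_loop A B C).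
Local Notation S := (stabilizing A B C).
Local Notation Sigma := (second_moment D).
Local Notation value := (value_mx A B C Q W).
Local Notation f := (cost A B C Q W D).

(* If [AK K] had an eigenpair with [0 <= Re z], the quadratic form of the value
   matrices of nearby gains, which stay bounded, would force [C] to vanish on the
   eigenvectors, against observability. *)
Lemma stabilizing_limit K c :
  (forall rho, 0 < rho -> exists V, [/\ `|V| <= rho, S (K + V) & f (K + V) <= c]) ->
  S K.
Proof.
move=> near z /eigenvalue_real_pair[x [y xy]]; rewrite ltNge; apply/negP => z0.
have [c0 c00 trc] := posdef_trace_coercive hSigma.
pose beta := c / c0.
have [d d0 dB] : mxnorm_order 1 (fun V => B *m V *m C).
  exact: mxnorm_orderM (mxnorm_orderM (mxnorm_order_cst B) (@mxnorm_order_id R m p))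
    (mxnorm_order_cst C).
have bilQ v : 0 <= bil Q (C *m v) (C *m v) by case: (posdef_psd hQ).
set q := bil Q (C *m x) (C *m x) + bil Q (C *m y) (C *m y).
have q0 : 0 <= q by rewrite addr_ge0.
pose e := 2 * (n%:R * (beta * d) * (n * n)%:R * (frob x * frob x + frob y * frob y)).
(* In the Lyapunov equation at [K + V] the terms of [AK K] sum to [Re z] times a nonnegative number.
   Only the terms of [B *m V *m C] can balance the observed cost [q], and they are [O(rho)] because
   the value matrices stay bounded by [beta]. *)
have qle rho : 0 < rho -> q <= e * rho.
  move=> /near[V [VR SV fV]]; set P := value (K + V).
  have Pp : psd P by exact: value_mx_psd.
  have [Ps P0] := Pp.
  have trP : \tr P <= beta.
    rewrite ler_pdivlMr// mulrC; apply: le_trans (trc _ Pp) _.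
    by rewrite -(costE hQ hW hbounded).
  have Pb : `|P| <= beta.
    rewrite [leLHS]/Num.norm /= mx_normrE; apply/bigmax_leP; split.
      apply: le_trans trP; apply: sumr_ge0 => i _; exact: psd_diag_ge0.
    by move=> [i j] _; exact: le_trans (psd_entry_le_trace _ _ Pp) trP.
  have [P' [a [b cert]]] := hurwitz_lyap_cert SV.
  have lP v : 2 * bil P v (AK (K + V) *m v) = - bil (stage_cost C Q W (K + V)) v v.
    rewrite -bilNm -(lyapsolP cert) bilDm -bil_mull -bil_mulr -/(value _) -/P.
    by rewrite (bil_sym (AK _ *m _) _ Ps); ring.
  have Ml v : bil Q (C *m v) (C *m v) <= bil (stage_cost C Q W (K + V)) v v.
    by rewrite stage_costE lerDl; case: (posdef_psd hW).
  have split v : bil P v (AK (K + V) *m v) = bil P v (AK K *m v) - bil P v ((B *m V *m C) *m v).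
    by rewrite closed_loop_pert mulmxBl bilDr bilNr.
  have Eb v : `|bil P v ((B *m V *m C) *m v)| <=
      n%:R * (beta * d) * (n * n)%:R * (frob v * frob v) * rho.
    rewrite bil_mulr.
    have PE k l : `|(P *m (B *m V *m C)) k l| <= n%:R * (beta * (d * rho)).
      apply: le_trans (coord_le_mxnorm _ _ _) _; apply: le_trans (mxnormM _ _) _.
      rewrite ler_wpM2l// ler_pM//; apply: le_trans (dB V) _.
      by rewrite ler_wpM2l.
    apply: le_trans (bil_entry_bound _ _ PE) _.
    by rewrite le_eqVlt; apply/orP; left; apply/eqP; ring.
  have pos := eigenpair_bil Ps xy.
  have pos0 : 0 <= bil P x (AK K *m x) + bil P y (AK K *m y).
    by rewrite pos mulr_ge0// addr_ge0.
  have := lP x; have := lP y; have := Ml x; have := Ml y.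
  rewrite !split /q /e; have := Eb x; have := Eb y; rewrite !ler_norml.
  by move=> /andP[_ ?] /andP[_ ?]; move: pos0; lra.
have {}q0 : q = 0.
  apply/eqP; rewrite eq_le q0 andbT leNgt; apply/negP => qpos.
  pose rho := q / (2 * (`|e| + 1)).
  have e10 : 0 < `|e| + 1 by rewrite ltr_wpDl.
  have rho0 : 0 < rho by rewrite divr_gt0// mulr_gt0.
  have := qle _ rho0; apply/negP; rewrite -ltNge.
  apply: le_lt_trans (_ : (`|e| + 1) * rho < q).
    by rewrite ler_wpM2r ?(ltW rho0)//; apply: le_trans (ler_norm _) _; rewrite lerDl.
  have -> : (`|e| + 1) * rho = q / 2 by rewrite /rho; field; rewrite gt_eqF.
  by rewrite ltr_pdivrMr// ltr_pMr// ltr1n.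
have Cz v : bil Q (C *m v) (C *m v) = 0 -> C *m v = 0.
  move=> Q0; apply/eqP; apply: contraT => /(proj2 hQ); rewrite -/(bil _ _ _) Q0 ltxx //.
have qx : bil Q (C *m x) (C *m x) = 0.
  by apply/eqP; rewrite eq_le bilQ andbT -q0 lerDl.
have qy : bil Q (C *m y) (C *m y) = 0.
  by apply/eqP; rewrite eq_le bilQ andbT -q0 lerDr.
have [Cx Cy] := (Cz _ qx, Cz _ qy).
(* On the kernel of [C] the matrices [AK K] and [A] agree, so the pair is an eigenpair of [A]
   itself. *)
apply: (@observable_eigenpair _ _ _ A C z x y hobs) => //.
case: xy => h e1 e2; split; [exact: h|rewrite -e1|rewrite -e2];
  by rewrite /closed_loop mulmxBl -!mulmxA ?Cx ?Cy !mulmx0 subr0.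
Qed.

End sublevel_closed.

(** * Projected descent *)

Section line_descent.
Context {R : realType} {m p : nat}.
Variables (f : 'M[R]_(m, p) -> R) (G : 'M[R]_(m, p) -> 'M[R]_(m, p)).
Variables (S : set 'M[R]_(m, p)) (f0 : R).
Let S0 : set 'M[R]_(m, p) := [set K | S K /\ f K <= f0].
Hypothesis f_derive : forall K V, S K -> is_derive K V f (mxdot (G K) V).
Hypothesis f_loc : forall K, S K -> exists rho c, [/\ 0 < rho, 0 <= c &
  forall V, `|V| <= rho -> S (K + V) /\ `|f (K + V) - f K| <= c * `|V|].
Hypothesis S0_limit : forall K,
  (forall rho, 0 < rho -> exists2 V, `|V| <= rho & S0 (K + V)) -> S0 K.
Variables (K V : 'M[R]_(m, p)).
Let g (t : R) : R := f (K + t *: V).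

Lemma is_derive_line t : S (K + t *: V) ->
  is_derive t (1 : R) g (mxdot (G (K + t *: V)) V).
Proof.
move=> St; have [h1 h2] := f_derive V St.
have e : (fun h : R => h^-1 *: (g (h *: 1 + t) - g t)) =
         (fun h : R => h^-1 *: (f (h *: V + (K + t *: V)) - f (K + t *: V))).
  apply/funext => h; congr (_ *: (f _ - _)).
  by rewrite addrCA -scalerDl [h *: 1]mulr1.
by apply: DeriveDef; rewrite /derivable /derive e.
Qed.

Variables (L mu : R).
Hypothesis mu_gtL : L / 2 < mu.
Hypothesis L0 : 0 < L.
Hypothesis hLip : forall K K', S0 K -> S0 K' ->
  frob (G K - G K') <= L * frob (K - K').
Hypothesis K_S0 : S0 K.
Hypothesis slopeV : mxdot (G K) V <= - mu * frob V ^+ 2.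
Hypothesis V0 : 0 < frob V.

(** Along the segment the slope is at most [(- mu + L s) |V|^2]; integrating, and using
    [mu t - L t^2 / 2 >= (mu - L / 2) t] for [t <= 1], gives the bound. Membership in [S0] is asked
    strictly before [t] only, which is what is known below a supremum. *)
Lemma line_decrease t : 0 < t -> t <= 1 ->
  (forall s, 0 <= s -> s < t -> S0 (K + s *: V)) -> S (K + t *: V) ->
  f (K + t *: V) <= f K - (mu - L / 2) * t * frob V ^+ 2.
Proof.
move=> t0 t1 S0s St.
have Ss s : 0 <= s -> s <= t -> S (K + s *: V).
  by move=> s0; rewrite le_eqVlt => /orP[/eqP->//|st]; case: (S0s s s0 st).
pose q s := mu * s - L / 2 * s ^+ 2.
have dq s : is_derive s (1 : R) q (mu - L * s).
  have h := is_deriveB (is_deriveZ mu (is_derive_id s (1 : R)))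
    (is_deriveZ (L / 2) (@is_deriveX _ _ _ 2 _ _ _ (is_derive_id s (1 : R)))).
  apply: is_derive_eq h _; by rewrite /= /GRing.scale /= expr1; field.
pose h s := g s + frob V ^+ 2 *: q s.
have dh u : 0 <= u -> u <= t ->
    is_derive u (1 : R) h (mxdot (G (K + u *: V)) V + frob V ^+ 2 *: (mu - L * u)).
  move=> s0 st; apply: is_deriveD; first exact/is_derive_line/Ss.
have : h t <= h 0.
  apply: (@ler0_derive1_nincr _ h 0 t) => //; last exact: ltW.
  - move=> s; rewrite in_itv/= => /andP[/ltW s0 /ltW st].
    by case: (dh s s0 st).
  - move=> s; rewrite in_itv/= => /andP[s0 st].
    rewrite derive1E (@derive_val _ _ _ _ _ _ _ (dh s (ltW s0) (ltW st))).
    have hL := hLip (S0s s (ltW s0) st) K_S0.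
    have := mxdot_CS (G (K + s *: V) - G K) V.
    rewrite mxdotDl mxdotNl.
    move: hL; rewrite addrAC subrr add0r frobZ gtr0_norm// => hL cs.
    have h2 := ler_wpM2r (ltW V0) hL.
    have -> : frob V ^+ 2 *: (mu - L * s) = frob V ^+ 2 * mu - L * (s * frob V) * frob V.
      by rewrite /GRing.scale /=; ring.
    by move: slopeV; rewrite mulNr; lra.
  - apply: derivable_within_continuous => s; rewrite in_itv/= => /andP[s0 st].
    by case: (dh s s0 st).
rewrite /h /g /q scale0r addr0 expr0n /= !mulr0 subr0 scaler0 addr0.
rewrite /GRing.scale /= => ht.
have : frob V ^+ 2 * (L / 2 * (t * (1 - t))) >= 0.
  apply: mulr_ge0; first exact: sqr_ge0.
  by apply: mulr_ge0; [rewrite divr_ge0// ltW|rewrite mulr_ge0 ?subr_ge0// ltW].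
by move: ht; rewrite expr2; lra.
Qed.

(* The supremum of the times up to which the segment stays in [S0] is attained
   since [S0] is closed, and is not below 1 since the cost has dropped by then. *)
Lemma line_sublevel t : 0 <= t -> t <= 1 -> S0 (K + t *: V).
Proof.
pose T := [set t : R | [/\ 0 <= t, t <= 1 & forall s, 0 <= s -> s <= t -> S0 (K + s *: V)]].
have T0 : T 0.
  split=> // s s0 s1; have -> : s = 0 by apply/eqP; rewrite eq_le s0 s1.
  by rewrite scale0r addr0.
have Tsup : has_sup T by split; [exists 0|exists 1 => u []].
pose ts := sup T.
have ts0 : 0 <= ts by apply: ub_le_sup => //; case: Tsup.
have ts1 : ts <= 1 by apply: ge_sup; [exists 0|move=> u []].
have below s : 0 <= s -> s < ts -> S0 (K + s *: V).
  move=> s0 sts; have [|u Tu su] := @sup_adherent _ T (ts - s) _ Tsup.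
    by rewrite subr_gt0.
  case: Tu => _ _; apply => //; rewrite -/ts in su.
  by move: su; rewrite subKr => /ltW.
have dk : 0 < `|V|.
  rewrite lt_neqAle normr_ge0 andbT eq_sym normr_eq0; apply: contraTneq V0 => ->.
  by rewrite -[X in frob X](scale0r 0) frobZ normr0 mul0r ltxx.
have Sts : S0 (K + ts *: V).
  have [ts00|ts_gt0] := eqVneq ts 0; first by rewrite ts00 scale0r addr0.
  have {ts_gt0}ts_gt0 : 0 < ts by rewrite lt_neqAle eq_sym ts_gt0.
  apply: S0_limit => rho rho0.
  pose e := Num.min (rho / `|V|) (ts / 2).
  have e0 : 0 < e by rewrite lt_min !divr_gt0.
  exists (- e *: V).
    rewrite normrZ normrN gtr0_norm// -ler_pdivlMr//.
    by rewrite ge_min lexx.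
  rewrite -addrA -scalerDl; apply: below; last by rewrite gtrDl oppr_lt0.
  rewrite subr_ge0; apply: (@le_trans _ _ (ts / 2)); first by rewrite ge_min lexx orbT.
  by rewrite ler_pdivrMr// ler_peMr// ler1n.
have ts_eq1 : ts = 1.
  apply/eqP; rewrite eq_le ts1 leNgt; apply/negP => ts_lt1.
  have [rho [c [rho0 c0 loc]]] := f_loc Sts.1.
  suff [e [e0 He]] : exists e, 0 < e /\
      forall s, 0 < s -> s <= e -> S0 (K + (ts + s) *: V).
    pose e' := Num.min e (1 - ts).
    have e'0 : 0 < e' by rewrite lt_min e0 subr_gt0.
    have : T (ts + e').
      split; first by rewrite addr_ge0// ltW.
        by rewrite -lerBrDl ge_min lexx orbT.
      move=> s s0 sle; have [sts|sts|->//] := ltgtP s ts; first exact: below.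
      have -> : s = ts + (s - ts) by rewrite addrC subrK.
      apply: He; rewrite ?subr_gt0//.
      rewrite lerBlDl; apply: le_trans sle _; rewrite lerD2l.
      by rewrite ge_min lexx.
    move=> /(@ub_le_sup _ T (proj2 Tsup)); rewrite -/ts.
    by rewrite leNgt ltrDl e'0.
  have inS s : 0 < s -> s <= rho / `|V| -> S (K + (ts + s) *: V) /\
      `|f (K + (ts + s) *: V) - f (K + ts *: V)| <= c * (s * `|V|).
    move=> s0 sr; have := loc (s *: V); rewrite -addrA -scalerDl normrZ gtr0_norm//.
    by apply; rewrite -ler_pdivlMr.
  (* At [ts = 0] no decrease has accumulated and [f K] may equal [f0], so the strictly negative
     slope at [K] starts the motion. For [ts > 0] the decrease [eta] reached at [ts] leaves room for
     the local Lipschitz growth of [f] just after it. *)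
  have [ts00|ts_gt0] := eqVneq ts 0.
    have [cv dv] := f_derive V K_S0.1.
    have {dv cv}cv : h^-1 *: (f (h *: V + K) - f K) @[h --> 0^'] -->
        mxdot (G K) V by rewrite -dv; exact: cv.
    have neg : mxdot (G K) V < 0.
      apply: le_lt_trans slopeV _; rewrite mulNr oppr_lt0 mulr_gt0 ?exprn_gt0//.
      by apply: lt_trans mu_gtL; rewrite divr_gt0.
    have [e /= e0 He] : \forall h \near 0^', h^-1 *: (f (h *: V + K) - f K) < 0.
      exact: (cvgr_lt _ cv).
    exists (Num.min (e / 2) (rho / `|V|)); split; first by rewrite lt_min !divr_gt0.
    move=> s s0; rewrite le_min => /andP[se sr]; have [Ss _] := inS s s0 sr.
    have se' : s < e by apply: le_lt_trans se _; rewrite ltr_pdivrMr// ltr_pMr// ltr1n.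
    split=> //; have := He s; rewrite /= sub0r normrN gtr0_norm//.
    move=> /(_ se' (lt0r_neq0 s0)).
    rewrite -[_ *: _]/(_ * _) pmulr_rlt0 ?invr_gt0// subr_lt0 ts00 add0r addrC => /ltW h.
    by apply: le_trans h _; case: K_S0.
  have {ts_gt0}ts_gt0 : 0 < ts by rewrite lt_neqAle eq_sym ts_gt0.
  have dec := line_decrease ts_gt0 ts1 below Sts.1.
  pose eta := (mu - L / 2) * ts * frob V ^+ 2.
  have eta0 : 0 < eta by rewrite !mulr_gt0 ?exprn_gt0// subr_gt0.
  have cV : 0 < (c + 1) * `|V| by rewrite mulr_gt0// ltr_wpDl.
  exists (Num.min (rho / `|V|) (eta / ((c + 1) * `|V|))).
  split; first by rewrite lt_min !divr_gt0.
  move=> s s0; rewrite le_min => /andP[sr se]; have [Ss fs] := inS s s0 sr.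
  split=> //; move: fs; rewrite ler_norml => /andP[_ fs].
  have fK : f K <= f0 by case: K_S0.
  have h2 : c * (s * `|V|) <= eta.
    move: se; rewrite ler_pdivlMr// => se; apply: le_trans se.
    by rewrite (mulrCA s) ler_wpM2r ?mulr_ge0 ?(ltW s0)// lerDl.
  by move: dec; rewrite -/eta; lra.
move=> t0 t1; move: (t1); rewrite -ts_eq1 le_eqVlt => /orP[/eqP->//|]; exact: below.
Qed.

Lemma line_step : S0 (K + V) /\ f (K + V) <= f K - (mu - L / 2) * frob V ^+ 2.
Proof.
have h := line_sublevel ler01 (lexx 1); rewrite scale1r in h; split=> //.
have := @line_decrease 1 ltr01 (lexx 1); rewrite scale1r mulr1; apply; last exact: h.1.
by move=> s s0 /ltW; exact: line_sublevel.
Qed.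

End line_descent.


Local Opaque cost.

Section descent.
Context {R : realType} {n m p : nat}.
Variables (A : 'M[R]_n) (B : 'M[R]_(n, m)) (C : 'M[R]_(p, n)).
Variables (Q : 'M[R]_p) (W : 'M[R]_m).
Hypotheses (hQ : posdef Q) (hW : posdef W).
Variable D : probability (borel_mx R n 1) R.
Hypothesis hSigma : posdef (second_moment D).
Variable Pmax : R.
Hypothesis hbounded : {ae D, forall x, frob (x : 'cV[R]_n) <= Pmax}.
Hypothesis hobs : observable A C.
Variable K0 : 'M[R]_(m, p).
Implicit Type K V : 'M[R]_(m, p).

Local Notation S := (stabilizing A B C).
Local Notation f := (cost A B C Q W D).
Local Notation S0 := (sublevel A B C Q W D K0).

(** Bounded cost along the approximating gains makes the limit stabilizing; only then is the cost
    known to be locally Lipschitz there, and the inequality passes to the limit. *)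
Lemma sublevel_limit K :
  (forall rho, 0 < rho -> exists2 V, `|V| <= rho & S0 (K + V)) -> S0 K.
Proof.
move=> near; have SK : S K.
  apply: (stabilizing_limit hQ hW hSigma hbounded hobs (c := f K0)) => rho.
  by move=> /near[V VR [SV fV]]; exists V; split.
split; first exact: SK.
have [rho [c [rho0 c0 loc]]] := cost_locally_lipschitz hQ hW hbounded SK.
apply/ler_addgt0Pr => e e0.
have c10 : 0 < c + 1 by rewrite ltr_wpDl.
have [|V] := near (Num.min rho (e / (c + 1))); first by rewrite lt_min rho0 divr_gt0.
rewrite le_min => /andP[V1 V2] [_ fV]; have [_] := loc _ V1.
rewrite ler_norml => /andP[h _].
have h2 : c * `|V| <= e.
  move: V2; rewrite ler_pdivlMr// => V2; apply: le_trans V2.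
  by rewrite mulrC ler_wpM2l// lerDl.
move: fV h h2; move: (f (K + V)) (f K) (f K0) (c * `|V|) => a b k x; lra.
Qed.

Lemma sublevel_closed : closed S0.
Proof.
move=> K clK; apply: sublevel_limit => rho rho0.
have [|N [SN KN]] := clK (ball K rho); first exact: nbhsx_ballx.
exists (N - K); last by rewrite addrC subrK.
by move: KN; rewrite -ball_normE /ball_ /= distrC => /ltW.
Qed.

End descent.

(** * Projected steps with inexact gradients and the stopping test *)

Section projected_descent.
Context {R : realType} {m p : nat}.
Variables (f : 'M[R]_(m, p) -> R) (G : 'M[R]_(m, p) -> 'M[R]_(m, p)).
Variables (S : set 'M[R]_(m, p)) (K0 : 'M[R]_(m, p)).
Let S0 : set 'M[R]_(m, p) := [set K | S K /\ f K <= f K0].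
Hypothesis f_ge0 : forall K, 0 <= f K.
Hypothesis f_derive : forall K V, S K -> is_derive K V f (mxdot (G K) V).
Hypothesis f_loc : forall K, S K -> exists rho c, [/\ 0 < rho, 0 <= c &
  forall V, `|V| <= rho -> S (K + V) /\ `|f (K + V) - f K| <= c * `|V|].
Hypothesis S0_limit : forall K,
  (forall rho, 0 < rho -> exists2 V, `|V| <= rho & S0 (K + V)) -> S0 K.
Variable Omega : set 'M[R]_(m, p).
Hypothesis Oclosed : closed Omega.
Hypothesis Oconvex : convex_set (Omega : set (convex_lmodType 'M[R]_(m, p))).
Hypothesis OK0 : Omega K0.
Hypothesis SK0 : S K0.
Variables (lambda eps L alpha : R).
Hypotheses (lambda0 : 0 < lambda) (eps0 : 0 < eps).
Hypothesis L0 : 0 < L.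
Hypothesis hLip : forall K K', S0 K -> S0 K' -> frob (G K - G K') <= L * frob (K - K').
Hypotheses (alpha0 : 0 < alpha) (alpha1 : alpha < 2 * (1 - lambda) / L).
Local Notation proj := (Pilot.Defs.proj Omega).
Local Notation O0 := (ex_intro Omega K0 OK0).

Let mu := (1 - lambda) / alpha.

(** The step-size condition on [alpha], in the form that the descent along a segment requires. *)
Lemma step_gap : L / 2 < mu.
Proof.
rewrite /mu ltr_pdivlMr// mulrAC ltr_pdivrMr//.
by move: alpha1; rewrite ltr_pdivlMr//; lra.
Qed.

(** Testing the projection inequality with [K] itself gives [<E, V> <= - |V|^2 / alpha]. The
    estimation error adds at most [lambda eps |V|], and [eps < |V| / alpha] because the step is
    long, so the true slope is at most [- mu |V|^2]. *)
Lemma projected_step K E : Omega K -> S0 K -> frob (E - G K) <= lambda * eps ->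
  let K' := proj (K - alpha *: E) in eps * alpha < frob (K' - K) ->
  S0 K' /\ f K' <= f K - (mu - L / 2) * frob (K' - K) ^+ 2.
Proof.
move=> OK SK Eb K' KK'; pose V := K' - K.
have KV : K' = K + V by rewrite addrC subrK.
have V0 : 0 < frob V by apply: lt_trans KK'; rewrite mulr_gt0.
have KE : K - alpha *: E - K' = - (alpha *: E) - V.
  by rewrite /V opprB addrAC [in RHS]addrC.
have var := proj_variational Oclosed Oconvex O0 (K - alpha *: E) OK.
rewrite -/K' -[K - K']opprB KE -/V in KK' var *; clearbody V.
have {}var : alpha * mxdot E V <= - frob V ^+ 2.
  by move: var; rewrite !mxdotE !opprK frob_sqr; lra.
have cs := mxdot_CS (G K - E) V; rewrite mxdotDl mxdotNl frobB in cs.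
have h1 : frob (E - G K) * frob V <= lambda * (frob V ^+ 2 / alpha).
  apply: le_trans (ler_wpM2r (ltW V0) Eb) _.
  rewrite expr2 -!mulrA ler_pM2l// [leLHS]mulrC ler_pM2l//.
  by rewrite ler_pdivlMr// ltW.
have h2 : mxdot E V <= - (frob V ^+ 2 / alpha).
  by rewrite -mulNr ler_pdivlMr// mulrC.
rewrite KV; apply: (line_step f_derive f_loc S0_limit step_gap L0 hLip SK _ V0).
have -> : - mu * frob V ^+ 2 = - (frob V ^+ 2 / alpha) + lambda * (frob V ^+ 2 / alpha).
  by rewrite /mu; field; rewrite gt_eqF.
by move: cs h1 h2; lra.
Qed.

Variables (E : nat -> 'M[R]_(m, p) -> 'M[R]_(m, p)) (K : nat -> 'M[R]_(m, p)) (T : nat).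
Hypothesis K_0 : K 0%N = K0.
Hypothesis K_S : forall i, K i.+1 = proj (K i - alpha *: E i (K i)).
Hypothesis E_accurate : forall i, (i < T)%N -> S0 (K i) ->
  frob (E i (K i) - G (K i)) <= lambda * eps.
Let T' := find (fun i => frob (K i.+1 - K i) <= eps * alpha) (iota 0 T).

Lemma iterate_Omega i : Omega (K i).
Proof.
by case: i => [|i]; [rewrite K_0|rewrite K_S; case: (projP Oclosed O0 (K i - alpha *: E i (K i)))].
Qed.

Lemma stop_le : (T' <= T)%N.
Proof. by rewrite /T' -[X in (_ <= X)%N](size_iota 0 T) find_size. Qed.

Lemma before_stop i : (i < T')%N -> eps * alpha < frob (K i.+1 - K i).
Proof.
move=> iT; have := before_find 0%N iT; rewrite nth_iota ?add0n.
  by move=> /negbT; rewrite -ltNge.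
exact: leq_trans iT stop_le.
Qed.

Lemma at_stop : (T' < T)%N -> frob (K T'.+1 - K T') <= eps * alpha.
Proof.
move=> TT; have : has (fun i => frob (K i.+1 - K i) <= eps * alpha) (iota 0 T).
  by rewrite has_find size_iota.
by move=> /(nth_find 0%N); rewrite nth_iota.
Qed.

Let eta := eps ^+ 2 * alpha ^+ 2 * (mu - L / 2).

Lemma eta_gt0 : 0 < eta.
Proof. by rewrite !mulr_gt0 ?exprn_gt0// subr_gt0 step_gap. Qed.

Lemma iterate_sublevel i : (i <= T')%N -> S0 (K i).
Proof.
elim: i => [_|i IH iT]; first by rewrite K_0; split.
have iT0 : (i < T)%N by exact: leq_trans iT stop_le.
have Si := IH (ltnW iT); rewrite K_S.
have [] // := projected_step (iterate_Omega i) Si (E_accurate iT0 Si).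
by rewrite -K_S before_stop.
Qed.

Lemma iterate_decrease i : (i < T')%N -> f (K i.+1) <= f (K i) - eta.
Proof.
move=> iT; have iT0 : (i < T)%N by exact: leq_trans iT stop_le.
have Si := iterate_sublevel (ltnW iT).
have [] := projected_step (iterate_Omega i) Si (E_accurate iT0 Si).
  by rewrite -K_S before_stop.
rewrite -K_S => _ h; apply: le_trans h _; rewrite lerD2l lerN2.
rewrite /eta mulrC ler_pM2l ?subr_gt0 ?step_gap// -exprMn.
by rewrite ler_pXn2r ?nnegrE ?frob_ge0 ?mulr_ge0 ?ltW// before_stop.
Qed.

Lemma iterate_decrease_sum i : (i <= T')%N -> f (K i) <= f K0 - i%:R * eta.
Proof.
elim: i => [_|i IH iT]; first by rewrite K_0 mul0r subr0.
have := iterate_decrease iT; have := IH (ltnW iT).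
by rewrite -natr1 mulrDl mul1r; lra.
Qed.

Lemma projected_gradient_descent :
  [/\ forall i, (i <= T')%N -> S (K i),
      forall i, (i < T')%N -> f (K i.+1) < f (K i) &
      f K0 / eta < T%:R ->
      frob (alpha^-1 *: (proj (K T' - alpha *: G (K T')) - K T')) <=
        (1 + lambda) * eps].
Proof.
split=> [i iT|i iT|fT].
- by case: (iterate_sublevel iT).
- by apply: le_lt_trans (iterate_decrease iT) _; rewrite gtrDl oppr_lt0 eta_gt0.
(* Without a stop, [T] decreases of at least [eta] would push the nonnegative cost below 0. *)
have TT : (T' < T)%N.
  rewrite ltn_neqAle stop_le andbT; apply: contraTneq fT => TT.
  rewrite -leNgt ler_pdivlMr ?eta_gt0//.
  have := iterate_decrease_sum (leqnn T'); rewrite {2}TT => h.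
  by rewrite -subr_ge0; exact: le_trans (f_ge0 _) h.
rewrite frobZ ger0_norm ?invr_ge0 ?(ltW alpha0)// mulrC ler_pdivrMr//.
set K' := K T'; have St : S0 K' by exact: iterate_sublevel.
have Eb := E_accurate TT St; rewrite -/K' in Eb.
have stop := at_stop TT; rewrite K_S -/K' in stop.
(* The exact projected step is compared with the estimated one: nonexpansiveness puts them within
   [alpha lambda eps] of each other, and the stopping test bounds the estimated step by
   [eps alpha]. *)
rewrite -[X in frob X](subrKA (proj (K' - alpha *: E T' K'))).
apply: le_trans (frobD _ _) _.
have := proj_nonexpansive Oclosed Oconvex O0 (K' - alpha *: G K') (K' - alpha *: E T' K').
have dE (x y z : 'M[R]_(m, p)) : x - y - (x - z) = z - y.
  by rewrite opprB addrC addrA subrK.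
rewrite dE -scalerBr frobZ gtr0_norm//.
have := ler_wpM2l (ltW alpha0) Eb.
by move: stop; lra.
Qed.

End projected_descent.

(** * Measurability of the estimates *)

Section entrywise_measurability.
Context {R : realType} {d : measure_display} {T : measurableType d}.

(** Working entrywise reduces matrix algebra to real functions; [mx_measurable_borel] and
    [borel_mx_measurable] identify this with Borel measurability. *)
Definition mx_measurable m n (F : T -> 'M[R]_(m, n)) : Prop :=
  forall i j, measurable_fun setT (fun w => F w i j).

Lemma mx_measurable_cst m n (M : 'M[R]_(m, n)) : mx_measurable (fun=> M).
Proof. by move=> i j; exact: measurable_cst. Qed.

Lemma mx_measurableD m n (F G : T -> 'M[R]_(m, n)) :
  mx_measurable F -> mx_measurable G -> mx_measurable (fun w => F w + G w).
Proof.
move=> mF mG i j; rewrite (_ : (fun w => _) = (fun w => F w i j) \+ (fun w => G w i j)).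
  exact: measurable_funD.
by apply/funext => w; rewrite mxE.
Qed.

Lemma mx_measurableZ m n (a : T -> R) (F : T -> 'M[R]_(m, n)) :
  measurable_fun setT a -> mx_measurable F -> mx_measurable (fun w => a w *: F w).
Proof.
move=> ma mF i j; rewrite (_ : (fun w => _) = a \* (fun w => F w i j)).
  exact: measurable_funM.
by apply/funext => w; rewrite mxE.
Qed.

Lemma mx_measurableN m n (F : T -> 'M[R]_(m, n)) :
  mx_measurable F -> mx_measurable (fun w => - F w).
Proof.
move=> mF; under eq_fun do rewrite -scaleN1r.
exact: mx_measurableZ.
Qed.

Lemma mx_measurableM m n p (F : T -> 'M[R]_(m, n)) (G : T -> 'M[R]_(n, p)) :
  mx_measurable F -> mx_measurable G -> mx_measurable (fun w => F w *m G w).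
Proof.
move=> mF mG i j; under eq_fun do rewrite mxE.
by apply: measurable_sum => k; exact: measurable_funM.
Qed.

Lemma mx_measurable_tr m n (F : T -> 'M[R]_(m, n)) :
  mx_measurable F -> mx_measurable (fun w => (F w)^T).
Proof.
move=> mF i j; rewrite (_ : (fun w => _) = (fun w => F w j i)); first exact: mF.
by apply/funext => w; rewrite mxE.
Qed.

Lemma mx_measurable_sum m n (I : Type) (s : seq I) (F : I -> T -> 'M[R]_(m, n)) :
  (forall k, mx_measurable (F k)) -> mx_measurable (fun w => \sum_(k <- s) F k w).
Proof.
move=> mF i j; under eq_fun do rewrite summxE.
by apply: measurable_sum => k; exact: mF.
Qed.

(** Each entry is a pointwise limit of measurable functions, the partial sums of its power series at
    1. *)
Lemma mx_measurable_expmx n (F : T -> 'M[R]_n) :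
  mx_measurable F -> mx_measurable (fun w => expmx (F w)).
Proof.
move=> mF i j.
apply: (@measurable_fun_cvg _ _ _ _
  (fun N w => pseries (expmx_coef 1%:M (F w) i j) 1 N)); last first.
  by move=> w _; rewrite -[F w]scale1r expmxE scale1r; exact: is_cvg_expmx_coef.
move=> N; apply: measurable_sum => k.
apply: measurable_funM => //; apply: measurable_funM => //.
have mX : mx_measurable (fun w => F w ^+ k).
  elim: k => [|k IH]; first exact: mx_measurable_cst.
  by under eq_fun do rewrite exprS; exact: mx_measurableM.
by under eq_fun do rewrite mul1mx; exact: mX.
Qed.

Lemma measurable_frob m n (F : T -> 'M[R]_(m, n)) :
  mx_measurable F -> measurable_fun setT (fun w => frob (F w)).
Proof.
move=> mF; rewrite /frob; apply: (@measurableT_comp _ _ _ _ _ _ (@Num.sqrt R)).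
  by apply: continuous_measurable_fun; exact: sqrt_continuous.
apply: measurable_sum => i; apply: measurable_sum => j.
exact: measurable_funX.
Qed.

End entrywise_measurability.

Lemma mx_measurable_comp (R : realType) d d' (T : measurableType d)
    (T' : measurableType d') m n (F : T' -> 'M[R]_(m, n)) (h : T -> T') :
  measurable_fun setT h -> mx_measurable F -> mx_measurable (F \o h).
Proof. by move=> mh mF i j; apply: (measurableT_comp (mF i j) mh). Qed.

(* An open set of matrices is the union of the boxes with rational centre and
   radius [1 / (k + 1)] that it contains. *)
Lemma mx_measurable_borel (R : realType) d (T : measurableType d) m n
    (F : T -> 'M[R]_(m, n)) :
  mx_measurable F -> measurable_fun setT (F : T -> borel_mx R m n).
Proof.
move=> mF; apply: (@measurability _ _ T (borel_mx R m n) setT F (@open 'M[R]_(m, n))) => //.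
move=> _ [ O oO <-]; rewrite setTI.
pose box (q : 'M[rat]_(m, n) * nat) : set 'M[R]_(m, n) :=
  [set M | forall i j, `|M i j - ratr (q.1 i j)| < q.2.+1%:R^-1].
pose V (q : 'M[rat]_(m, n) * nat) : set T :=
  if `[< box q `<=` O >] then F @^-1` box q else set0.
rewrite (_ : F @^-1` O = \bigcup_q V q).
  apply: countable_bigcupT_measurable => // q; rewrite /V.
  case: asboolP => // _.
  rewrite (_ : F @^-1` box q = \bigcap_(ij in [set: 'I_m * 'I_n])
    [set w | `|F w ij.1 ij.2 - ratr (q.1 ij.1 ij.2)| < q.2.+1%:R^-1]).
    apply: fin_bigcap_measurable => // -[i j] _ /=.
    rewrite -[X in measurable X]setTI.
    apply: (measurable_fun_ltr _ _ measurableT) => //.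
    apply: measurableT_comp => //; apply: measurable_funB => //.
  by apply/seteqP; split=> w /= h => [[i j] _|i j]; [exact: h|exact: (h (i, j))].
apply/seteqP; split=> w /=; last first.
  by move=> [q _]; rewrite /V; case: asboolP => // bO /bO.
move=> Ow; have /nbhs_ballP[r /= r0 rO] : nbhs (F w) O by exact: open_nbhs_nbhs.
(* Two points of a box of radius [1 / (k + 1)] differ by less than [2 / (k + 1)] in every entry,
   whence the factor 2. *)
have [k kr] : exists k : nat, 2 * k.+1%:R^-1 < r.
  exists (Num.truncn (2 / r)).
  by rewrite ltr_pdivrMr ?ltr0n// mulrC -ltr_pdivrMr// truncnS_gt.
have k0 : 0 < k.+1%:R^-1 :> R by rewrite invr_gt0.
have dense i j : exists q : rat, `|F w i j - ratr q| < k.+1%:R^-1.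
  move: (k.+1%:R^-1) k0 => e e0.
  have [|q] := @rat_in_itvoo R (F w i j - e) (F w i j + e); first by lra.
  rewrite in_itv/= => /andP[h1 h2]; exists q.
  by rewrite ltr_norml; apply/andP; split; lra.
pose q := \matrix_(i, j) (projT1 (cid (dense i j))).
exists (q, k) => //; rewrite /V.
have Fq : box (q, k) (F w).
  by move=> i j /=; rewrite mxE; exact: (projT2 (cid (dense i j))).
case: asboolP => // nb; exfalso; apply: nb => N Nb; apply: rO.
split=> // i j; rewrite /ball /= (le_lt_trans _ kr)//.
have := ler_distD (ratr (q i j)) (F w i j) (N i j).
have h1 := Fq i j; have := Nb i j; rewrite /= distrC => h2 h3.
apply: le_trans h3 _; move: h1 h2 => /=; move: (k.+1%:R^-1) => e.
by rewrite (distrC (ratr _)); lra.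
Qed.

Lemma measurable_comp_continuous_mx (R : realType) d (T : measurableType d) m n
    (F : T -> 'M[R]_(m, n)) (h : 'M[R]_(m, n) -> R) :
  mx_measurable F -> continuous h -> measurable_fun setT (h \o F).
Proof.
move=> /mx_measurable_borel mF /borel_continuous_measurable mh.
exact: measurableT_comp mh mF.
Qed.

Lemma borel_mx_measurable (R : realType) d (T : measurableType d) m n
    (F : T -> borel_mx R m n) :
  measurable_fun setT F -> mx_measurable (F : T -> 'M[R]_(m, n)).
Proof.
move=> mF i j; have mc := @borel_continuous_measurable R m n (fun M => M i j)
  (@coord_continuous R m n i j).
exact: (measurableT_comp mc mF).
Qed.

Lemma mx_measurable_preimage (R : realType) d (T : measurableType d) m n
    (F : T -> 'M[R]_(m, n)) (E : set (borel_mx R m n)) :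
  mx_measurable F -> measurable E -> measurable (F @^-1` E).
Proof.
by move=> /mx_measurable_borel mF mE; rewrite -[X in measurable X]setTI; exact: mF.
Qed.

Section estimate_measurability.
Context {R : realType} {n m p : nat}.
Variables (A : 'M[R]_n) (B : 'M[R]_(n, m)) (C : 'M[R]_(p, n)).
Variables (Q : 'M[R]_p) (W : 'M[R]_m).
Hypotheses (hQ : posdef Q) (hW : posdef W).
Context {d : measure_display} {T : measurableType d}.

(** The integrand is nonnegative and jointly measurable in outcome and time, so Tonelli applies once
    the time interval is written as an indicator. *)
Lemma measurable_sample_cost (tau : R) (F : T -> 'M[R]_(m, p)) (X : T -> 'cV[R]_n) :
  mx_measurable F -> mx_measurable X ->
  measurable_fun setT (fun w => sample_cost A B C Q W tau (F w) (X w)).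
Proof.
move=> mF mX.
pose x (z : T * R) := expmx (z.2 *: closed_loop A B C (F z.1)) *m X z.1.
pose y z := C *m x z.
pose u z := - (F z.1 *m y z).
pose h (z : T * R) : R := ((y z)^T *m Q *m y z) 0 0 + ((u z)^T *m W *m u z) 0 0.
have mF1 : mx_measurable (fun z : T * R => F z.1).
  exact: mx_measurable_comp (@measurable_fst _ _ _ _) mF.
have mX1 : mx_measurable (fun z : T * R => X z.1).
  exact: mx_measurable_comp (@measurable_fst _ _ _ _) mX.
have mx : mx_measurable x.
  apply: mx_measurableM => //; apply/mx_measurable_expmx/mx_measurableZ => //.
  apply: mx_measurableD; first exact: mx_measurable_cst.
  apply: mx_measurableN; apply: mx_measurableM; last exact: mx_measurable_cst.
  by apply: mx_measurableM => //; exact: mx_measurable_cst.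
have my : mx_measurable y by apply: mx_measurableM => //; exact: mx_measurable_cst.
have mu : mx_measurable u by apply: mx_measurableN; exact: mx_measurableM.
have mq k (M : 'M[R]_k) (v : T * R -> 'cV[R]_k) : mx_measurable v ->
    measurable_fun setT (fun z => ((v z)^T *m M *m v z) 0 0).
  move=> mv; apply: mx_measurableM => //; apply: mx_measurableM.
    exact: mx_measurable_tr.
  exact: mx_measurable_cst.
have mh : measurable_fun setT h by apply: measurable_funD; exact: mq.
have h0 z : 0 <= h z.
  by rewrite addr_ge0//; [case: (posdef_psd hQ) => _; apply|case: (posdef_psd hW) => _; apply].
pose g (z : T * R) : \bar R := (h z * \1_(`[0, tau]%classic : set R) z.2)%:E.
have mg : measurable_fun setT g.
  apply/measurable_EFinP/measurable_funM => //.
  by apply: measurableT_comp => //; exact: measurable_indic.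
have g0 z : (0 <= g z)%E by rewrite lee_fin mulr_ge0// indicE ler0n.
have mI := @measurable_fun_fubini_tonelli_F _ _ T (measurableTypeR R) R
  (@lebesgue_measure R) g mg g0.
rewrite (_ : (fun w => _) = fine \o fubini_F (@lebesgue_measure R) g).
  by apply: measurableT_comp mI; exact: fine_measurable.
apply/funext => w; rewrite /sample_cost /Rintegral /= /fubini_F; congr fine.
rewrite [LHS]integral_mkcond; apply: eq_integral => t _.
rewrite /patch /g indicE; case: ifPn => _ /=; last by rewrite mulr0.
by rewrite mulr1.
Qed.

Lemma mx_measurable_gradient_estimate (N : nat) (r tau : R) (F : T -> 'M[R]_(m, p))
    (U : 'I_N -> T -> 'M[R]_(m, p)) (X : 'I_N -> T -> 'cV[R]_n) :
  mx_measurable F -> (forall k, mx_measurable (U k)) -> (forall k, mx_measurable (X k)) ->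
  mx_measurable (fun w => gradient_estimate A B C Q W r tau (F w) (U ^~ w) (X ^~ w)).
Proof.
move=> mF mU mX; apply: mx_measurableZ; first exact: measurable_cst.
apply: mx_measurable_sum => k; apply: mx_measurableZ => //.
apply: measurable_sample_cost => //; apply: mx_measurableD => //.
by apply: mx_measurableZ => //; exact: measurable_cst.
Qed.

End estimate_measurability.

(** A Lipschitz map on [S0] has relatively open preimages of intervals, and [S0], being closed, is
    Borel. The value 0 outside is needed because [G] is controlled on [S0] only. *)
Lemma borel_lipschitz_on_measurable (R : realType) m p (S0 : set 'M[R]_(m, p))
    (G : 'M[R]_(m, p) -> 'M[R]_(m, p)) (L : R) :
  closed S0 ->
  (forall K K', S0 K -> S0 K' -> frob (G K - G K') <= L * frob (K - K')) ->
  forall d (T : measurableType d) (F : T -> 'M[R]_(m, p)), mx_measurable F ->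
  mx_measurable (fun w => if `[< S0 (F w) >] then G (F w) else 0).
Proof.
move=> S0c GL d T F mF i j.
suff mG : measurable_fun setT
    ((fun K => if `[< S0 K >] then G K i j else 0) : borel_mx R m p -> R).
  rewrite (_ : (fun w => _) = (fun K => if `[< S0 K >] then G K i j else 0) \o F).
    exact: measurableT_comp mG (mx_measurable_borel mF).
  by apply/funext => w /=; case: ifP; rewrite ?mxE.
have mS0 : measurable (S0 : set (borel_mx R m p)).
  rewrite -[S0]setCK; apply: measurableC; apply: sub_sigma_algebra.
  exact: closed_openC.
apply: (measurability _ (RGenOpens.measurableE R)).
move=> _ [_ [a [b ->]] <-]; rewrite setTI.
set I := `]a, b[%classic.
(* An open set that cuts out of [S0] exactly the points where entry [i, j] of [G] lies in [I]. *)
pose V : set 'M[R]_(m, p) := \bigcup_(K in S0 `&` [set K | I (G K i j)])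
  interior [set M | S0 M -> I (G M i j)].
rewrite (_ : _ @^-1` I = (S0 `&` V) `|` (~` S0 `&` [set K | I 0])).
  apply: measurableU.
    apply: measurableI => //; apply: sub_sigma_algebra.
    by apply: bigcup_open => K _; exact: open_interior.
  apply: measurableI; first exact: measurableC.
  have [I0|I0] := pselect (I 0).
    rewrite (_ : [set K | I 0] = setT); first exact: measurableT.
    by apply/seteqP; split.
  rewrite (_ : [set K | I 0] = set0); first exact: measurable0.
  by apply/seteqP; split.
apply/seteqP; split=> K /=.
  case: asboolP => SK IK; last by right.
  left; split=> //; exists K => //; rewrite /interior.
  have /nbhs_ballP[e /= e0 eI] : nbhs (G K i j) I.
    by apply: open_nbhs_nbhs; split => //; exact: interval_open.
  have L10 : 0 < `|L| + 1 by rewrite ltr_wpDl.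
  apply/frob_nbhs; exists (e / (`|L| + 1)); first exact: divr_gt0.
  move=> M MK SM; apply: eI; rewrite /ball /=.
  have := coord_le_frob (G K - G M) i j; rewrite !mxE => h.
  apply: le_lt_trans h _; apply: le_lt_trans (GL _ _ SK SM) _.
  move: MK; rewrite frobB ltr_pdivlMr// => MK; apply: le_lt_trans MK.
  rewrite mulrC ler_wpM2l ?frob_ge0//.
  by apply: le_trans (ler_norm _) _; rewrite lerDl.
move=> [[SK [M _ /interior_subset /(_ SK) IK]]|[SK I0]]; first by rewrite asboolT.
by rewrite asboolF.
Qed.

(** * Independence of past and present samples *)

(** A vanishing integral of [c - g] would force [g = c] almost everywhere, impossible on a space of
    mass 1. It keeps the failure probability strictly below [delta] after averaging over the
    past. *)
Lemma probability_integral_lt (R : realType) d (T : measurableType d)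
    (m : probability T R) (g : T -> \bar R) (c : R) :
  measurable_fun setT g -> (forall x, 0 <= g x)%E -> (forall x, g x < c%:E)%E ->
  (\int[m]_x g x < c%:E)%E.
Proof.
move=> mg g0 gc.
have gfin x : g x \is a fin_num.
  by rewrite ge0_fin_numE ?g0//; apply: lt_trans (gc x) _; rewrite ltry.
pose h x := (c%:E - g x)%E.
have mh : measurable_fun setT h by apply: emeasurable_funB => //; exact: measurable_cst.
have h0 x : (0 <= h x)%E by rewrite sube_ge0 ?gfin// ltW.
have cE : c%:E = (\int[m]_x g x + \int[m]_x h x)%E.
  rewrite -ge0_integralD//.
  rewrite (eq_integral (cst c%:E)); last by move=> x _; rewrite /h addeC subeK.
  rewrite integral_cst// -[LHS]mule1; congr (_ * _)%E.
  exact/esym/probability_setT.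
have hpos : (0 < \int[m]_x h x)%E.
  rewrite lt_neqAle integral_ge0// andbT; apply/eqP => /esym h00.
  have : (\int[m]_x `|h x| = 0)%E.
    by rewrite -[RHS]h00; apply: eq_integral => x _; rewrite gee0_abs.
  move/(ae_eq_integral_abs _ _ mh).1 => /(_ measurableT) [N [mN N0 hN]].
  have NT : N = setT.
    apply/seteqP; split=> // x _; apply: hN => /(_ I) /= hx.
    by have := gc x; rewrite -sube_gt0 -/(h x) hx ltxx.
  have := probability_setT m; rewrite -NT => /(etrans (esym N0)) /esym/eqP.
  by rewrite onee_eq0.
have ifin : (\int[m]_x g x \is a fin_num)%E.
  rewrite ge0_fin_numE ?integral_ge0//.
  apply: (@le_lt_trans _ _ c%:E); last exact: ltry.
  by rewrite cE leeDl// ltW.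
by rewrite cE lteDl.
Qed.

Section independent_pair.
Context {R : realType} {d d1 d2 : measure_display}.
Context {S : measurableType d} {T1 : measurableType d1} {T2 : measurableType d2}.
Variable P : probability S R.
Variables (X1 : {mfun S >-> T1}) (X2 : {mfun S >-> T2}).
Hypothesis indep : forall E1 E2, measurable E1 -> measurable E2 ->
  P (X1 @^-1` E1 `&` X2 @^-1` E2) = (P (X1 @^-1` E1) * P (X2 @^-1` E2))%E.

(** Independence makes the law of the pair the product of the two laws, so the probability is the
    mean of those of the sections. *)
Lemma independent_sections_lt (E : set (T1 * T2)) (c : R) : measurable E ->
  (forall x, P [set w | E (x, X2 w)] < c%:E)%E ->
  (P [set w | E (X1 w, X2 w)] < c%:E)%E.
Proof.
move=> mE Ec.
have mX : measurable_fun setT (fun w => (X1 w, X2 w)) by exact: measurable_fun_pair.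
pose X12 : {mfun S >-> (T1 * T2)%type} :=
  HB.pack (fun w => (X1 w, X2 w)) (isMeasurableFun.Build _ _ S (T1 * T2)%type _ mX).
have prodE := @product_measure_unique _ _ T1 T2 R (distribution P X1)
  (distribution P X2) (distribution P X12).
have -> : P [set w | E (X1 w, X2 w)] = distribution P X12 E by [].
rewrite -prodE//.
rewrite /product_measure1 /=.
apply: probability_integral_lt.
- exact: measurable_fun_xsection.
- by move=> x; exact: measure_ge0.
move=> x; apply: le_lt_trans (Ec x).
rewrite le_eqVlt; apply/orP; left; apply/eqP; congr (P _).
by apply/seteqP; split=> w; rewrite /xsection /= inE.
Qed.

End independent_pair.

(** Both sides are finite measures in [B] that agree on a generating class stable under intersection
    and containing the whole space. *)
Lemma independent_generated (R : realType) d (S : measurableType d)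
    (P : probability S R) (A : set S) (G : set (set S)) :
  measurable A -> G `<=` measurable -> G setT -> setI_closed G ->
  (forall B, G B -> P (A `&` B) = (P A * P B)%E) ->
  forall B, <<s G >> B -> P (A `&` B) = (P A * P B)%E.
Proof.
move=> mA Gm GT GI indep B GB.
have PA : P A = (fine (P A))%:E by rewrite fineK// fin_num_measure.
have r0 : 0 <= fine (P A) by rewrite fine_ge0.
pose m1 : {measure set S -> \bar R} := mrestr P mA.
pose m2 : {measure set S -> \bar R} := mscale (NngNum r0) P.
suff : m1 B = m2 B.
  by rewrite /m1 /m2 /= /mrestr /mscale /= -PA setIC.
apply: (@g_sigma_algebra_measure_unique _ _ _ G Gm (fun=> setT)) => //.
- by rewrite bigcup_const.
- move=> C GC; rewrite /m1 /m2 /= /mrestr /mscale /= -PA setIC; exact: indep.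
- move=> _; rewrite /m1 /= /mrestr setTI; apply: le_lt_trans (probability_le1 P mA) _.
  exact: ltry.
Qed.

Section independent_families.
Context {R : realType} {d : measure_display} {S : measurableType d}.
Variable P : probability S R.
Variables (I : finType) (G : I -> set (set S)).
Hypothesis Gm : forall i, G i `<=` measurable.
Hypothesis GI : forall i, setI_closed (G i).
Hypothesis GT : forall i, G i setT.
Hypothesis Gindep : mutually_independent P G.

(** A class stable under intersection that generates the joint sigma-algebra of the family [J]. *)
Definition rectangles (J : {set I}) : set (set S) :=
  [set A | exists2 E, (forall i, i \in J -> G i (E i)) &
                      A = \bigcap_(i in [set` J]) E i].

Lemma rectangles_measurable J : rectangles J `<=` measurable.
Proof.
move=> _ [E EG ->]; apply: fin_bigcap_measurable; first exact: finite_finset.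
by move=> i /= iJ; exact/Gm/EG.
Qed.

Lemma rectanglesT J : rectangles J setT.
Proof.
exists (fun=> setT) => [i _|]; first exact: GT.
by rewrite bigcapT.
Qed.

Lemma rectanglesI J : setI_closed (rectangles J).
Proof.
move=> _ _ [E EG ->] [F FG ->]; exists (fun i => E i `&` F i).
  by move=> i iJ; apply: GI; [exact: EG|exact: FG].
by rewrite bigcapI.
Qed.

Lemma sub_rectangles (J : {set I}) i : i \in J -> G i `<=` rectangles J.
Proof.
move=> iJ A GA; exists (fun k => if k == i then A else setT).
  by move=> k _; case: eqP => [->//|_]; exact: GT.
apply/seteqP; split=> w /=; first by move=> Aw k _; case: eqP.
by move=> /(_ i iJ); rewrite eqxx.
Qed.

Lemma independent_rectangles (J1 J2 : {set I}) A B : (forall i, i \in J1 -> i \notin J2) ->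
  rectangles J1 A -> rectangles J2 B -> P (A `&` B) = (P A * P B)%E.
Proof.
move=> J12 [E EG ->] [F FG ->].
pose H i := if i \in J1 then E i else F i.
have J2N1 i : i \in J2 -> i \in J1 = false.
  by move=> iJ; apply: contraTF iJ; exact: J12.
have HE i : i \in J1 -> H i = E i by rewrite /H => ->.
have HF i : i \in J2 -> H i = F i by move=> iJ; rewrite /H J2N1.
have -> : \bigcap_(i in [set` J1]) E i `&` \bigcap_(i in [set` J2]) F i =
    \bigcap_(i in [set` J1 :|: J2]) H i.
  apply/seteqP; split=> w /=.
    move=> [wE wF] i /=; rewrite inE => /orP[iJ|iJ].
      by rewrite HE//; exact: wE.
    by rewrite HF//; exact: wF.
  move=> wH; split=> i /= iJ.
    by rewrite -HE//; apply: wH; rewrite /= inE iJ.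
  by rewrite -HF//; apply: wH; rewrite /= inE iJ orbT.
rewrite !Gindep//; last first.
  move=> i; rewrite inE => /orP[iJ|iJ]; first by rewrite HE//; exact: EG.
  by rewrite HF//; exact: FG.
rewrite (bigID (mem J1)) /=; congr (_ * _)%E.
  apply: eq_big => [i|i /andP[_ iJ]]; last by congr (P _); exact: HE.
  by rewrite inE; case: (i \in J1); rewrite ?andbF.
apply: eq_big => [i|i /andP[]].
  rewrite inE; case: (boolP (i \in J1)) => /= [/J12/negbTE ->//|_].
  by rewrite andbT.
by rewrite inE => /orP[-> //|iJ _]; congr (P _); exact: HF.
Qed.

(** The product rule is extended from rectangles to generated sigma-algebras one argument at a
    time. *)
Lemma independent_sigma (J1 J2 : {set I}) A B : (forall i, i \in J1 -> i \notin J2) ->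
  <<s rectangles J1 >> A -> <<s rectangles J2 >> B ->
  P (A `&` B) = (P A * P B)%E.
Proof.
move=> J12 JA JB.
have sub J : <<s rectangles J >> `<=` measurable.
  by apply: smallest_sub; [exact: sigma_algebra_measurable|exact: rectangles_measurable].
have h A' : rectangles J1 A' -> P (A' `&` B) = (P A' * P B)%E.
  move=> J1A; apply: (independent_generated (G := rectangles J2)) => //.
  - exact: rectangles_measurable J1A.
  - exact: rectangles_measurable.
  - exact: rectanglesT.
  - exact: rectanglesI.
  - by move=> C J2C; exact: (independent_rectangles J12).
rewrite setIC muleC.
apply: (independent_generated (G := rectangles J1)) => //.
- exact: sub JB.
- exact: rectangles_measurable.
- exact: rectanglesT.
- exact: rectanglesI.
- by move=> C J1C; rewrite setIC muleC; exact: h.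
Qed.

End independent_families.

Section sigma_of_family.
Context {R : realType} {d d' : measure_display}.
Context {S : measurableType d} {T : measurableType d'}.
Variable P : probability S R.
Variable X : {RV P >-> T}.

Lemma sigma_of_measurable : sigma_of X `<=` measurable.
Proof. by move=> _ [B mB <-]; exact: measurable_funPT. Qed.

Lemma sigma_ofT : sigma_of X setT.
Proof. by exists setT => //; rewrite setTI. Qed.

Lemma sigma_ofI : setI_closed (sigma_of X).
Proof.
move=> _ _ [E mE <-] [F mF <-]; exists (E `&` F); first exact: measurableI.
by rewrite !setTI.
Qed.

End sigma_of_family.

(** Serves to extract the samples of a single iteration from the whole family. *)
Lemma mutually_independent_inj (R : realType) d (S : measurableType d)
    (P : probability S R) (I I' : finType) (G : I -> set (set S)) (h : I' -> I) :
  injective h -> mutually_independent P G -> mutually_independent P (G \o h).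
Proof.
move=> hinj indep J E EG.
pose E' i := odflt setT (omap E [pick k | h k == i]).
have E'h k : E' (h k) = E k.
  rewrite /E'; case: pickP => [k' /eqP/hinj -> //|/(_ k)].
  by rewrite eqxx.
have := indep (h @: J) E'; rewrite big_imset /=; last by move=> ? ? _ _; exact: hinj.
rewrite (eq_bigr (fun k => P (E k))); last by move=> k _; rewrite E'h.
move=> <-; last by move=> _ /imsetP[k kJ ->]; rewrite E'h; exact: EG.
congr (P _); apply/seteqP; split=> w wE /=.
  by move=> _ /= /imsetP[k kJ ->]; rewrite E'h; exact: wE.
by move=> k /= kJ; rewrite -E'h; apply: wE; apply: imset_f.
Qed.

(** * Accuracy of the estimates along the random iterates *)

Section sequential_accuracy.
Context {R : realType} {m p n : nat} {d : measure_display} {S : measurableType d}.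
Variable P : probability S R.
Variables (N T : nat).
Variable U : nat -> 'I_N -> {RV P >-> borel_mx R m p}.
Variable X : nat -> 'I_N -> {RV P >-> borel_mx R n 1}.
Let I : finType := ('I_T * 'I_N + 'I_T * 'I_N)%type.
Let G (s : I) : set (set S) :=
  match s with
  | inl i => sigma_of (U i.1 i.2)
  | inr i => sigma_of (X i.1 i.2)
  end.
Hypothesis indep : mutually_independent P G.

Variable est : 'M[R]_(m, p) -> ('I_N -> 'M[R]_(m, p)) -> ('I_N -> 'cV[R]_n) -> 'M[R]_(m, p).
Hypothesis est_measurable : forall d' (T' : measurableType d') (F : T' -> 'M[R]_(m, p))
    (V : 'I_N -> T' -> 'M[R]_(m, p)) (Y : 'I_N -> T' -> 'cV[R]_n),
  mx_measurable F -> (forall k, mx_measurable (V k)) -> (forall k, mx_measurable (Y k)) ->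
  mx_measurable (fun w => est (F w) (V ^~ w) (Y ^~ w)).
Variable grad : 'M[R]_(m, p) -> 'M[R]_(m, p).
Variable S0 : set 'M[R]_(m, p).
Hypothesis S0_closed : closed S0.
Hypothesis grad_measurable : forall d' (T' : measurableType d') (F : T' -> 'M[R]_(m, p)),
  mx_measurable F -> mx_measurable (fun w => if `[< S0 (F w) >] then grad (F w) else 0).
Variable pr : 'M[R]_(m, p) -> 'M[R]_(m, p).
Hypothesis pr_continuous : continuous pr.
Variables (alpha e delta : R).
Hypothesis delta0 : 0 < delta.
Variable K : nat -> S -> 'M[R]_(m, p).
Variable K0 : 'M[R]_(m, p).
Hypothesis K_0 : forall w, K 0%N w = K0.
Hypothesis K_S : forall i w, K i.+1 w = pr (K i w - alpha *: est (K i w) (U i ^~ w) (X i ^~ w)).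
Hypothesis acc : forall j M, (j < T)%N -> S0 M -> holds_with_prob_gt P (1 - delta)
  [set w | frob (est M (U j ^~ w) (X j ^~ w) - grad M) <= e].

Let time (s : I) : nat := match s with inl i => i.1 | inr i => i.1 end.
Let past (j : nat) : {set I} := finset (fun s : I => (time s < j)%N).
Let now (j : nat) : {set I} := finset (fun s : I => time s == j).
(** The sample space itself with a coarser sigma-algebra: depending only on the samples in [J]
    becomes measurability on this type. *)
Let sigma_type (J : {set I}) := g_sigma_algebraType (rectangles G J).

Let G_measurable s : G s `<=` measurable.
Proof. by case: s => i; exact: sigma_of_measurable. Qed.

Let G_I s : setI_closed (G s).
Proof. by case: s => i; exact: sigma_ofI. Qed.

Let G_T s : G s setT.
Proof. by case: s => i; exact: sigma_ofT. Qed.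

Let sub_sigma_type (J : {set I}) s : s \in J ->
  G s `<=` (@measurable _ (sigma_type J)).
Proof.
by move=> sJ A GA; apply: sub_sigma_algebra; exact: (sub_rectangles G_T sJ).
Qed.

Lemma sample_U_measurable (J : {set I}) (i : 'I_T) k : inl (i, k) \in J ->
  mx_measurable (U i k : sigma_type J -> 'M[R]_(m, p)).
Proof.
move=> iJ; apply: borel_mx_measurable => _ B mB; apply: (sub_sigma_type iJ).
by exists B.
Qed.

Lemma sample_X_measurable (J : {set I}) (i : 'I_T) k : inr (i, k) \in J ->
  mx_measurable (X i k : sigma_type J -> 'M[R]_(n, 1)).
Proof.
move=> iJ; apply: borel_mx_measurable => _ B mB; apply: (sub_sigma_type iJ).
by exists B.
Qed.

(** Passing to iterate [i + 1] consumes samples of time [i < j], so the induction never leaves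
    [past j]; continuity carries measurability through [pr]. *)
Lemma iterate_measurable j i : (j <= T)%N -> (i <= j)%N ->
  mx_measurable (K i : sigma_type (past j) -> 'M[R]_(m, p)).
Proof.
move=> jT; elim: i => [_|i IH ij].
  rewrite (_ : K 0%N = fun=> K0); first exact: mx_measurable_cst.
  by apply/funext => w; exact: K_0.
have iT : (i < T)%N by exact: leq_trans ij jT.
have mK := IH (ltnW ij).
have me : mx_measurable ((fun w => est (K i w) (U i ^~ w) (X i ^~ w)) :
    sigma_type (past j) -> 'M[R]_(m, p)).
  apply: est_measurable => // k.
    by apply: (@sample_U_measurable _ (Ordinal iT)); rewrite inE.
  by apply: (@sample_X_measurable _ (Ordinal iT)); rewrite inE.
rewrite (_ : K i.+1 = fun w => pr (K i w - alpha *: est (K i w) (U i ^~ w) (X i ^~ w))).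
  move=> a b; apply: (@measurable_comp_continuous_mx R _ (sigma_type (past j)) m p
    (fun w => K i w - alpha *: est (K i w) (U i ^~ w) (X i ^~ w)) (fun M => pr M a b)).
    apply: mx_measurableD => //; apply: mx_measurableN; apply: mx_measurableZ => //.
  move=> M; apply: (@continuous_comp _ _ _ pr (fun M => M a b)).
    exact: pr_continuous.
  exact: coord_continuous.
by apply/funext => w; exact: K_S.
Qed.

(** The first conjunct is there because accuracy is assumed for gains in [S0] only. *)
Definition inaccurate j : set S :=
  [set w | S0 (K j w) /\ e < frob (est (K j w) (U j ^~ w) (X j ^~ w) - grad (K j w))].

(* The iterate [K j] depends on the past samples only. With these frozen, [acc]
   bounds the probability of the event over the present samples, and Fubini for
   the product of the two independent sigma-algebras gives the bound. *)
Lemma inaccurate_lt j : (j < T)%N ->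
  measurable (inaccurate j) /\ (P (inaccurate j) < delta%:E)%E.
Proof.
move=> jT.
pose J1 := past j; pose J2 := now j.
have J12 s : s \in J1 -> s \notin J2 by rewrite !inE; case: ltngtP.
have sub J A : <<s rectangles G J >> A -> measurable A.
  move: A; apply: smallest_sub; first exact: sigma_algebra_measurable.
  exact: rectangles_measurable.
have mid J : measurable_fun setT (id : S -> sigma_type J).
  by move=> _ A mA; rewrite setTI; exact: sub mA.
(* Both maps are the identity into coarser sigma-algebras: pairing an outcome with itself separates
   its dependence through the past from that through the present. *)
pose X1 : {mfun S >-> sigma_type J1} :=
  HB.pack (id : S -> sigma_type J1) (isMeasurableFun.Build _ _ S (sigma_type J1) _ (mid J1)).
pose X2 : {mfun S >-> sigma_type J2} :=
  HB.pack (id : S -> sigma_type J2) (isMeasurableFun.Build _ _ S (sigma_type J2) _ (mid J2)).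
have ind E1 E2 : measurable E1 -> measurable E2 ->
    P (X1 @^-1` E1 `&` X2 @^-1` E2) = (P (X1 @^-1` E1) * P (X2 @^-1` E2))%E.
  by move=> mE1 mE2; exact: (independent_sigma G_measurable G_I G_T indep J12).
(* The first coordinate drives the iterate, the second the fresh samples; on the diagonal this is
   [inaccurate j]. *)
pose E : set (sigma_type J1 * sigma_type J2) :=
  [set w | S0 (K j w.1)] `&`
  [set w | e < frob (est (K j w.1) (U j ^~ w.2) (X j ^~ w.2) -
             (if `[< S0 (K j w.1) >] then grad (K j w.1) else 0))].
have mK1 : mx_measurable (fun w : sigma_type J1 * sigma_type J2 => K j w.1).
  apply: (mx_measurable_comp (@measurable_fst _ _ _ _)).
  exact: (iterate_measurable (ltnW jT) (leqnn j)).
have mU2 k : mx_measurable (fun w : sigma_type J1 * sigma_type J2 => U j k w.2).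
  apply: (mx_measurable_comp (@measurable_snd _ _ _ _)).
  by apply: (@sample_U_measurable _ (Ordinal jT)); rewrite inE /=.
have mX2 k : mx_measurable (fun w : sigma_type J1 * sigma_type J2 => (X j k w.2 : 'M[R]_(n, 1))).
  apply: (mx_measurable_comp (@measurable_snd _ _ _ _)).
  by apply: (@sample_X_measurable _ (Ordinal jT)); rewrite inE /=.
have mE : measurable E.
  apply: measurableI.
    apply: (mx_measurable_preimage (F := fun w : sigma_type J1 * sigma_type J2 => K j w.1) mK1).
    rewrite -[S0]setCK; apply: measurableC; apply: sub_sigma_algebra.
    exact: closed_openC.
  rewrite -[X in measurable X]setTI.
  apply: (measurable_fun_ltr _ _ measurableT) => //.
  apply: measurable_frob; apply: mx_measurableD; first exact: est_measurable.
  apply: mx_measurableN; exact: grad_measurable.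
have EE : inaccurate j = [set w | E (X1 w, X2 w)].
  apply/seteqP; split=> w /= [Sw ew]; split=> //=; move: ew => /=;
    by rewrite asboolT.
have mEs x : measurable [set w | E (x, X2 w)].
  have mx := measurable_xsection x mE.
  have := mid J2 measurableT _ mx; rewrite setTI.
  by congr measurable; apply/seteqP; split=> w; rewrite /xsection /= inE.
split.
  rewrite EE.
  have mX12 : measurable_fun setT (fun w => (X1 w, X2 w)) by exact: measurable_fun_pair.
  by rewrite -[X in measurable X]setTI; exact: mX12.
rewrite EE; apply: (independent_sections_lt ind mE) => x.
(* Off [S0] the section is empty, of probability [0 < delta]. *)
have [Sx|Sx] := pselect (S0 (K j x)); last first.
  rewrite (_ : [set w | E (x, X2 w)] = set0) ?measure0 ?lte_fin//.
  by apply/seteqP; split=> w //= [].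
have [F [mF Fsub PF]] := acc jT Sx.
apply: (@le_lt_trans _ _ (P (~` F))).
  apply: le_measure; rewrite ?inE//; first exact: measurableC.
  move=> w [_ /=]; rewrite asboolT// => ew Fw.
  by have := Fsub _ Fw; rewrite /= leNgt ew.
rewrite probability_setC// -[P F]fineK ?fin_num_measure// -EFinB lte_fin.
by move: PF; rewrite -[P F]fineK ?fin_num_measure// lte_fin; lra.
Qed.

(** Each bad event has probability strictly below [delta], and [0 < T] keeps the inequality strict
    after summation. *)
Lemma accurate_throughout : (0 < T)%N -> holds_with_prob_gt P (1 - T%:R * delta)
  [set w | forall i, (i < T)%N -> S0 (K i w) ->
     frob (est (K i w) (U i ^~ w) (X i ^~ w) - grad (K i w)) <= e].
Proof.
move=> T0.
pose B := \big[setU/set0]_(i < T) inaccurate i.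
have mB : measurable B by apply: bigsetU_measurable => i _; case: (inaccurate_lt (ltn_ord i)).
exists (~` B); split.
- exact: measurableC.
- move=> w nB i iT Si; rewrite leNgt; apply/negP => ei; apply: nB.
  by rewrite /B -(bigcup_mkord T inaccurate); exists i; [exact: iT|split].
have Bfin i : (i < T)%N -> P (inaccurate i) = (fine (P (inaccurate i)))%:E.
  by move=> iT; rewrite fineK// fin_num_measure//; case: (inaccurate_lt iT).
have PB : (P B < (T%:R * delta)%:E)%E.
  apply: (@le_lt_trans _ _ (\sum_(i < T) P (inaccurate i))%E).
    by apply: Boole_inequality => i iT; case: (inaccurate_lt iT).
  rewrite (eq_bigr (fun i : 'I_T => (fine (P (inaccurate i)))%:E)); last first.
    by move=> i _; rewrite -Bfin.
  rewrite sumEFin lte_fin mulr_natl -[X in _ *+ X]card_ord -sumr_const.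
  apply: ltr_sum; first by apply/hasP; exists (Ordinal T0); rewrite ?mem_index_enum.
  by move=> i _; have [_] := inaccurate_lt (ltn_ord i); rewrite (Bfin _ (ltn_ord i)) lte_fin.
rewrite probability_setC// -[P B]fineK ?fin_num_measure// -EFinB lte_fin.
by move: PB; rewrite -[P B]fineK ?fin_num_measure// lte_fin; lra.
Qed.

End sequential_accuracy.

(** * The probabilistic and deterministic halves combined *)

Unset Implicit Arguments.

Theorem theorem3 (R : realType) (n m p : nat)
  (A : 'M[R]_n) (B : 'M[R]_(n, m)) (C : 'M[R]_(p, n))
  (hB : B != 0) (hC : C != 0)
  (Q : 'M[R]_p) (W : 'M[R]_m) (hQ : posdef Q) (hW : posdef W)
  (D : probability (borel_mx R n 1) R)
  (hSigma : posdef (second_moment D))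
  (Pmax : R) (hPmax : 0 < Pmax)
  (hbounded : {ae D, forall x, frob (x : 'cV[R]_n) <= Pmax})
  (hobs : observable A C)
  (Omega : set 'M[R]_(m, p))
  (hclosed : closed Omega)
  (hconvex : convex_set (Omega : set (convex_lmodType 'M[R]_(m, p))))
  (K0 : 'M[R]_(m, p))
  (hK0 : Omega K0) (hK0S : stabilizing A B C K0)
  (lambda eps delta : R)
  (hlambda0 : 0 < lambda) (hlambda1 : lambda < 1)
  (heps : 0 < eps) (hdelta : 0 < delta)
  (T : nat) (hT : (0 < T)%N)
  (N : nat) (r tau : R)
  (hadm : admissible A B C Q W D K0 N r tau (lambda * eps) delta)
  (L : R) (hL : 0 < L)
  (hLip : forall K K' : 'M[R]_(m, p),
     sublevel A B C Q W D K0 K -> sublevel A B C Q W D K0 K' ->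
     frob (gradient (cost A B C Q W D) K - gradient (cost A B C Q W D) K')
       <= L * frob (K - K'))
  (alpha : R) (halpha0 : 0 < alpha) (halpha1 : alpha < 2 * (1 - lambda) / L)
  (d : measure_display) (S : measurableType d) (P : probability S R)
  (U : nat -> 'I_N -> {RV P >-> borel_mx R m p})
  (X : nat -> 'I_N -> {RV P >-> borel_mx R n 1})
  (hsamples : iid_samples D (fun ik : 'I_T * 'I_N => U ik.1 ik.2)
                            (fun ik : 'I_T * 'I_N => X ik.1 ik.2)) :
  let f := cost A B C Q W D in
  let Kseq w := pgp_iterate A B C Q W Omega K0 alpha r tau
                  (fun i k => U i k w) (fun i k => X i k w) in
  let T' w := pgp_stop A B C Q W Omega K0 alpha eps r tau
                  (fun i k => U i k w) (fun i k => X i k w) T in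
  holds_with_prob_gt P (1 - T%:R * delta)
    [set w |
      [/\ forall i, (i <= T' w)%N -> stabilizing A B C (Kseq w i),
          forall i, (i < T' w)%N -> f (Kseq w i.+1) < f (Kseq w i) &
          f K0 / (eps ^+ 2 * alpha ^+ 2 * ((1 - lambda) / alpha - L / 2))
            < T%:R ->
          stationary A B C Q W D Omega alpha ((1 + lambda) * eps)
            (Kseq w (T' w))]].
Proof.
move=> f Kseq T'.
pose S0 := sublevel A B C Q W D K0.
pose est M (V : 'I_N -> 'M[R]_(m, p)) (Y : 'I_N -> 'cV[R]_n) :=
  gradient_estimate A B C Q W r tau M V Y.
have S0_closed : closed S0 by exact: (sublevel_closed hQ hW hSigma hbounded hobs).
have [_ _ _ _ acc] := hadm.
have [unif law indep] := hsamples.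
(* Accuracy is assumed over every sample space; the batch of iteration [j] is again an iid family
   under [P], independent as a subfamily of the whole. *)
have accU j M : (j < T)%N -> S0 M -> holds_with_prob_gt P (1 - delta)
    [set w | frob (est M (U j ^~ w) (X j ^~ w) - gradient f M) <= lambda * eps].
  move=> jT SM; apply: (acc _ SM); split.
  - by move=> k; exact: (unif (Ordinal jT, k)).
  - by move=> k; exact: (law (Ordinal jT, k)).
  pose h (s : 'I_N + 'I_N) : 'I_T * 'I_N + 'I_T * 'I_N :=
    match s with inl k => inl (Ordinal jT, k) | inr k => inr (Ordinal jT, k) end.
  have hinj : injective h by move=> [k|k] [l|l] // [->].
  have := mutually_independent_inj hinj indep.
  by congr (mutually_independent P); apply/funext => -[k|k].
have [F [mF Fsub PF]] := @accurate_throughout R m p n d S P N T U X indep est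
  (fun _ _ F V Y mF mV mY => mx_measurable_gradient_estimate A B C hQ hW r tau mF mV mY)
  (gradient f) S0 S0_closed
  (fun _ _ F mF => borel_lipschitz_on_measurable S0_closed hLip mF)
  (Pilot.Defs.proj Omega) (proj_continuous hclosed hconvex (ex_intro _ K0 hK0))
  alpha (lambda * eps) delta hdelta (fun i w => Kseq w i) K0
  (fun _ => erefl) (fun _ _ => erefl) accU hT.
exists F; split; [exact: mF| |exact: PF] => w /Fsub Fw.
(* On the good event the descent result is deterministic: it applies to each outcome [w], with the
   estimates seen as functions of the gain. *)
have [h1 h2 h3] := (@projected_gradient_descent R m p f (gradient f) (stabilizing A B C) K0
  (cost_ge0 A B C hQ hW D)
  (fun K V => @is_derive_cost R n m p A B C Q W hQ hW D Pmax hbounded K V)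
  (fun K => @cost_locally_lipschitz R n m p A B C Q W hQ hW D Pmax hbounded K)
  (@sublevel_limit R n m p A B C Q W hQ hW D hSigma Pmax hbounded hobs K0)
  Omega hclosed hconvex hK0 hK0S lambda eps L alpha hlambda0 heps hL hLip
  halpha0 halpha1 (fun i M => est M (U i ^~ w) (X i ^~ w)) (Kseq w) T
  erefl (fun _ => erefl) Fw).
rewrite /mkset.
split.
- exact: h1.
- exact: h2.
move=> fT; exact: h3.
Qed.
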